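(* Let $U=U_q(\mathfrak{sl}_2)$ with Casimir element $C$, comultiplication $\Delta$ and universal $R$-matrix $\mathcal{R}$, let $\widetilde{\mathcal{R}}=\mathcal{R}_{21}$, and let $C_{13}=C_{(1)}\otimes 1\otimes C_{(2)}$, where $\Delta(C)=C_{(1)}\otimes C_{(2)}$ in Sweedler notation. Then the identities $$\widetilde{\mathcal{R}}_{23}^{-1}\,C_{13}\,\widetilde{\mathcal{R}}_{23}=\mathcal{R}_{12}\,C_{13}\,\mathcal{R}_{12}^{-1},\qquad \widetilde{\mathcal{R}}_{12}^{-1}\,C_{13}\,\widetilde{\mathcal{R}}_{12}=\mathcal{R}_{23}\,C_{13}\,\mathcal{R}_{23}^{-1}$$ hold, and the two elements of $U^{\otimes 3}$ $$C_{13}^{(0)}=\widetilde{\mathcal{R}}_{23}^{-1}\,C_{13}\,\widetilde{\mathcal{R}}_{23}=\mathcal{R}_{12}\,C_{13}\,\mathcal{R}_{12}^{-1},\qquad C_{13}^{(1)}=\widetilde{\mathcal{R}}_{12}^{-1}\,C_{13}\,\widetilde{\mathcal{R}}_{12}=\mathcal{R}_{23}\,C_{13}\,\mathcal{R}_{23}^{-1}$$ belong to the centralizer $$\mathfrak{C}_3=\{X\in U^{\otimes 3}\ :\ [(\Delta\otimes \mathrm{id})\Delta(x),X]=0\ \text{ for all } x\in U\}.$$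
   Context: Let $q\in\mathbb{C}^*$ be not a root of unity (in particular $q\neq\pm1,\pm i$), with a fixed square root $q^{1/2}$. Write $[X]_q=\frac{q^X-q^{-X}}{q-q^{-1}}$, $[n]_q!=[n]_q[n-1]_q\cdots[1]_q$, $[0]_q!=1$. The algebra $U=U_q(\mathfrak{sl}_2)$ is the associative unital algebra over $\mathbb{C}$ generated by $E$, $F$ and the invertible element $q^{H}$ (with $q^{kH}=(q^H)^k$ for $k\in\mathbb{Z}$), with relations $q^HE=qEq^H$, $q^HF=q^{-1}Fq^H$, $[E,F]=[2H]_q=\frac{q^{2H}-q^{-2H}}{q-q^{-1}}$. The Casimir element, which is central, is $$C=-\frac{(q-q^{-1})^2}{q+q^{-1}}\left(FE+\frac{q\,q^{2H}+q^{-1}q^{-2H}}{(q-q^{-1})^2}\right).$$ The comultiplication is the algebra homomorphism $\Delta:U\to U\otimes U$ with $\Delta(E)=E\otimes q^{-H}+q^H\otimes E$, $\Delta(F)=F\otimes q^{-H}+q^H\otimes F$, $\Delta(q^H)=q^H\otimes q^H$; it is coassociative. The universal $R$-matrix and its flip are $$\mathcal{R}=q^{2(H\otimes H)}\sum_{n\ge0}\frac{(q-q^{-1})^n}{[n]_q!}q^{n(n-1)/2}(Eq^H\otimes q^{-H}F)^n,$$ $$\widetilde{\mathcal{R}}=\mathcal{R}_{21}=\sum_{n\ge0}\frac{(q-q^{-1})^n}{[n]_q!}q^{n(n-1)/2}(Fq^H\otimes q^{-H}E)^n\;q^{2(H\otimes H)}.$$ Writing $\mathcal{R}=\mathcal{R}^\alpha\otimes\mathcal{R}_\alpha$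 (sum over $\alpha$), $\mathcal{R}_{12}=\mathcal{R}^\alpha\otimes\mathcal{R}_\alpha\otimes1$, $\mathcal{R}_{23}=1\otimes\mathcal{R}^\alpha\otimes\mathcal{R}_\alpha$, $\mathcal{R}_{13}=\mathcal{R}^\alpha\otimes1\otimes\mathcal{R}_\alpha$, and similarly for $\widetilde{\mathcal{R}}=\mathcal{R}_\alpha\otimes\mathcal{R}^\alpha$. Interpretation of the series: for $n\ge0$ let $V_n$ be the simple $U$-module of dimension $n+1$ whose highest weight vector has $q^H$-eigenvalue $q^{n/2}$; put $\widehat{U^{\otimes k}}=\prod_{n_1,\dots,n_k\ge0}\mathrm{End}(V_{n_1}\otimes\cdots\otimes V_{n_k})$. Since $q$ is not a root of unity, $U^{\otimes k}$ embeds in $\widehat{U^{\otimes k}}$ and is identified with its image. The operator $q^{2(H\otimes H)}$ acts on a tensor product of weight vectors with $q^H$-eigenvalues $q^{m}$, $q^{m'}$ ($m,m'\in\frac12\mathbb{Z}$) as multiplication by $q^{2mm'}$, so $\mathcal{R}$ and $\widetilde{\mathcal{R}}$ are well-defined invertible elements of $\widehat{U^{\otimes 2}}$ (each sum is finite on each $V_{n_1}\otimes V_{n_2}$), and products with them are taken in $\widehat{U^{\otimes 3}}$. *)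

(* Defs.v *)
From HB Require Import structures.
From mathcomp Require Import all_boot all_order all_algebra.
From mathcomp Require Import boolp classical_sets.
From mathcomp.real_closed Require Import mxtens.
From mathcomp Require Import ring zify ssrAC.

Set Implicit Arguments.
Unset Strict Implicit.
Unset Printing Implicit Defensive.

Import GRing.Theory.
Local Open Scope ring_scope.
Local Open Scope quotient_scope.

Definition bilin (K : fieldType) (A B M : lmodType K) (f : A -> B -> M) :=
  (forall b, linear (f^~ b)) /\ (forall a, linear (f a)).

(* A formal sum of pure tensors is the list of its terms; scalars are absorbed
   in the first factor of a term. *)
Inductive tens_eq (K : fieldType) (A B : lmodType K) :
    seq (A * B) -> seq (A * B) -> Prop :=
| teq_refl s : tens_eq s s
| teq_sym s t : tens_eq s t -> tens_eq t s
| teq_trans t s u : tens_eq s t -> tens_eq t u -> tens_eq s u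
| teq_cat s s' t t' :
    tens_eq s s' -> tens_eq t t' -> tens_eq (s ++ t) (s' ++ t')
| teq_catC s t : tens_eq (s ++ t) (t ++ s)
| teq_zero b : tens_eq [:: (0, b)] [::]
| teq_addl a a' b : tens_eq [:: (a + a', b)] [:: (a, b); (a', b)]
| teq_addr a b b' : tens_eq [:: (a, b + b')] [:: (a, b); (a, b')]
| teq_scale c a b : tens_eq [:: (c *: a, b)] [:: (a, c *: b)].
Arguments tens_eq {K A B}.

Section TensQuot.
Variables (K : fieldType) (A B : lmodType K).

Definition tens_eqb (s t : seq (A * B)) := `[< tens_eq s t >].

Lemma tens_eqb_equiv : equiv_class_of tens_eqb.
Proof.
split=> [s|s t|t s u]; first by apply/asboolP; constructor.
  by apply/asboolP/asboolP; exact: teq_sym.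
by move=> /asboolP st /asboolP tu; apply/asboolP; exact: teq_trans st tu.
Qed.

Canonical tens_equivrel := EquivRelPack tens_eqb_equiv.

Definition tens := {eq_quot tens_equivrel}.
HB.instance Definition _ := Choice.on tens.
HB.instance Definition _ := EqQuotient.on tens.

Definition tensum (s : seq (A * B)) : tens := \pi_tens s.
Definition tpure a b : tens := tensum [:: (a, b)].

Lemma tensumP (s t : seq (A * B)) : tens_eq s t <-> tensum s = tensum t.
Proof.
split=> [st|/eqmodP/asboolP//]; first by apply/eqmodP/asboolP.
Qed.

Lemma tensum_repr X : tensum (repr X) = X.
Proof. exact: reprK. Qed.

Lemma repr_tensum s : tens_eq (repr (tensum s)) s.
Proof. by apply/tensumP; rewrite tensum_repr. Qed.

Definition tens_add (X Y : tens) := tensum (repr X ++ repr Y).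
Definition tens_scale (c : K) (X : tens) :=
  tensum [seq (c *: p.1, p.2) | p <- repr X].
Definition tens_opp (X : tens) := tens_scale (- 1) X.

Lemma tens_eq_map c (s t : seq (A * B)) : tens_eq s t ->
  tens_eq [seq (c *: p.1, p.2) | p <- s] [seq (c *: p.1, p.2) | p <- t].
Proof.
elim=> {s t} [s|s t _ IH|t s u _ IH1 _ IH2|s s' t t' _ IH1 _ IH2|s t|b|a a' b|a b b'|d a b].
- exact: teq_refl.
- exact: teq_sym.
- exact: teq_trans IH1 IH2.
- by rewrite !map_cat; exact: teq_cat.
- by rewrite !map_cat; exact: teq_catC.
- by rewrite /= scaler0; exact: teq_zero.
- by rewrite /= scalerDr; exact: teq_addl.
- exact: teq_addr.
- by rewrite /= !scalerA mulrC -scalerA; exact: teq_scale.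
Qed.

Lemma tensum_cat s t : tensum (s ++ t) = tens_add (tensum s) (tensum t).
Proof.
by apply/tensumP/teq_cat; apply: teq_sym; exact: repr_tensum.
Qed.

Lemma tensum_map c s :
  tensum [seq (c *: p.1, p.2) | p <- s] = tens_scale c (tensum s).
Proof. by apply/tensumP/tens_eq_map/teq_sym; exact: repr_tensum. Qed.

Lemma tensumW (P : tens -> Prop) : (forall s, P (tensum s)) -> forall X, P X.
Proof. by move=> Ps X; rewrite -[X]tensum_repr. Qed.

Lemma tens_addA : associative tens_add.
Proof.
elim/tensumW=> s; elim/tensumW=> t; elim/tensumW=> u.
by rewrite -!tensum_cat catA.
Qed.

Lemma tens_addC : commutative tens_add.
Proof.
elim/tensumW=> s; elim/tensumW=> t.
by rewrite -!tensum_cat; apply/tensumP; exact: teq_catC.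
Qed.

Lemma tens_add0 : left_id (tensum [::]) tens_add.
Proof. by elim/tensumW=> s; rewrite -tensum_cat. Qed.

Lemma tens_addN : left_inverse (tensum [::]) tens_opp tens_add.
Proof.
elim/tensumW=> s; rewrite /tens_opp -tensum_map -tensum_cat; apply/tensumP.
elim: s => [|[a b] s IH] /=; first exact: teq_refl.
set s' := [seq _ | _ <- s] in IH *.
apply: (@teq_trans _ _ _ ([:: (- 1 *: a, b); (a, b)] ++ (s' ++ s))).
  apply: (@teq_cat _ _ _ [:: (- 1 *: a, b)] [:: (- 1 *: a, b)]
    (s' ++ (a, b) :: s) ((a, b) :: s' ++ s)).
    exact: teq_refl.
  rewrite -cat_rcons -cats1 -[(a, b) :: s' ++ s]/(([:: (a, b)] ++ s') ++ s).
  by apply: teq_cat; [exact: teq_catC | exact: teq_refl].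
rewrite -[X in tens_eq _ X]/([::] ++ [::]); apply: teq_cat IH.
apply: teq_trans (teq_sym (teq_addl _ _ _)) _.
by rewrite scaleN1r addNr; exact: teq_zero.
Qed.

HB.instance Definition _ :=
  GRing.isZmodule.Build tens tens_addA tens_addC tens_add0 tens_addN.

Lemma tensumD s t : tensum (s ++ t) = tensum s + tensum t.
Proof. exact: tensum_cat. Qed.

Lemma tensumE s : tensum s = \sum_(p <- s) tpure p.1 p.2.
Proof.
elim: s => [|[a b] s IH]; first by rewrite big_nil.
by rewrite big_cons -IH -tensumD.
Qed.

Lemma tens_scaleA c d X : tens_scale c (tens_scale d X) = tens_scale (c * d) X.
Proof.
elim/tensumW: X => s; rewrite -!tensum_map -map_comp; congr tensum.
by apply: eq_map => p /=; rewrite scalerA.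
Qed.

Lemma tens_scale1 : left_id 1 tens_scale.
Proof.
elim/tensumW=> s; rewrite -tensum_map -[RHS]/(tensum s) -[in RHS](map_id s).
by congr tensum; apply: eq_map => -[a b]; rewrite /= scale1r.
Qed.

Lemma tens_scaleDr : right_distributive tens_scale +%R.
Proof.
move=> c; elim/tensumW=> s; elim/tensumW=> t.
by rewrite -tensumD -!tensum_map -tensumD map_cat.
Qed.

Lemma tens_scaleDl X : {morph tens_scale^~ X : c d / c + d}.
Proof.
move=> c d; elim/tensumW: X => s; rewrite -!tensum_map.
elim: s => [|[a b] s IH]; first by rewrite -tensumD.
rewrite /= -[LHS]/(tensum ([:: _] ++ _)) tensumD IH.
rewrite -[X in _ = X + _]/(tensum ([:: _] ++ _)).
rewrite -[X in _ = _ + X]/(tensum ([:: _] ++ _)) !tensumD.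
rewrite addrACA; congr (_ + _); rewrite -tensumD; apply/tensumP.
by rewrite scalerDl; exact: teq_addl.
Qed.

HB.instance Definition _ := GRing.Zmodule_isLmodule.Build K tens
  tens_scaleA tens_scale1 tens_scaleDr tens_scaleDl.

Lemma tpure_bilin : bilin tpure.
Proof.
have tl c a b : tpure (c *: a) b = c *: tpure a b.
  by rewrite /tpure -[RHS]tensum_map.
split=> [b c a a'|a c b b'].
  by rewrite -tl -tensumD; apply/tensumP; exact: teq_addl.
rewrite -tl -tensumD; apply/tensumP; apply: teq_trans (teq_addr _ _ _) _.
apply: (@teq_cat _ _ _ [:: _] [:: _] [:: _] [:: _]); last exact: teq_refl.
exact: teq_sym (teq_scale _ _ _).
Qed.

Lemma tens_ind (P : tens -> Prop) : P 0 ->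
  (forall a b X, P X -> P (tpure a b + X)) -> forall X, P X.
Proof.
move=> P0 PD; elim/tensumW; elim=> // -[a b] s IH.
by rewrite -[_ :: s]/([:: _] ++ _) tensumD; exact: PD.
Qed.

(* The linear map A (x) B -> M induced by f; it does not depend on the
   chosen representative as soon as f is bilinear (tlift_sum, tliftE). *)
Definition tlift (M : lmodType K) (f : A -> B -> M) (X : tens) : M :=
  \sum_(p <- repr X) f p.1 p.2.

Lemma tlift_sum (M : lmodType K) (f : A -> B -> M) s : bilin f ->
  tlift f (tensum s) = \sum_(p <- s) f p.1 p.2.
Proof.
case=> fl fr; rewrite /tlift; have := repr_tensum s.
move: (repr _) => t.
have f0 b : f 0 b = 0 by have := fl b (- 1) 0 0; rewrite !scaleN1r !addNr.
have fDl a a' b : f (a + a') b = f a b + f a' b.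
  by have := fl b 1 a a'; rewrite /= !scale1r.
have fDr a b b' : f a (b + b') = f a b + f a b'.
  by have := fr a 1 b b'; rewrite /= !scale1r.
have fr0 a : f a 0 = 0 by have := fr a (- 1) 0 0; rewrite !scaleN1r !addNr.
have fZ c a b : f (c *: a) b = f a (c *: b).
  have := fl b c a 0; have := fr a c b 0.
  by rewrite /= !addr0 f0 fr0 !addr0 => -> ->.
elim=> {s t} [//|s t _ -> //|t s u _ -> _ -> //|s s' t t' _ + _|s t|b|a a' b|a b b'|d a b].
- by rewrite !big_cat /= => -> ->.
- by rewrite !big_cat /= addrC.
- by rewrite big_seq1 big_nil.
- by rewrite !big_cons !big_nil !addr0 fDl.
- by rewrite !big_cons !big_nil !addr0 fDr.
- by rewrite !big_seq1 fZ.
Qed.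

Lemma tliftE (M : lmodType K) (f : A -> B -> M) : bilin f ->
  forall a b, tlift f (tpure a b) = f a b.
Proof. by move=> fP a b; rewrite tlift_sum// big_seq1. Qed.

Lemma tlift_linear (M : lmodType K) (f : A -> B -> M) :
  bilin f -> linear (tlift f).
Proof.
move=> fP c; elim/tensumW=> s; elim/tensumW=> t.
rewrite -[c *: _]tensum_map -tensumD !tlift_sum// big_cat/=; congr (_ + _).
rewrite big_map scaler_sumr; apply: eq_bigr => p _ /=.
case: fP => fl fr; have := fl p.2 c p.1 0.
have f0 b : f 0 b = 0 by have := fl b (- 1) 0 0; rewrite !scaleN1r !addNr.
by rewrite /= f0 !addr0.
Qed.

End TensQuot.

Arguments tpure {K A B}.
Notation "x \ox y" := (tpure x y) (at level 40, left associativity).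

Lemma exists_functional (K : fieldType) (V : lmodType K) (v : V) :
  v != 0 -> exists2 f : V -> K, linear (f : V -> K^o) & f v = 1.
Proof.
move=> v0.
pose P (W : set V) := ~ W v /\ forall c x y, W x -> W y -> W (c *: x + y).
have [W [[Wv Wlin] Wmax]] : exists W, P W /\ forall B, (W `<` B)%classic -> ~ P B.
  apply: Zorn_bigcup => F FP Ftot; split=> [[X FX Xv]|c x y [X FX Xx] [Y FY Yy]].
    by case: (FP _ FX).
  have [XY|YX] := Ftot _ _ FX FY.
    by exists Y => //; apply: (FP _ FY).2 => //; exact: XY.
  by exists X => //; apply: (FP _ FX).2 => //; exact: YX.
have W0 : W 0.
  apply: contrapT => nW0.
  apply: (Wmax (W `|` [set 0])%classic).
    by split=> [x Wx|/(_ 0)]; [left | move=> /(_ (or_intror erefl))].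
  split=> [[//|/= v0']|c x y]; first by rewrite v0' eqxx in v0.
  move=> [Wx|/= ->] [Wy|/= ->].
  - by left; exact: Wlin.
  - have [->|c0] := eqVneq c 0; first by right; rewrite scale0r addr0.
    exfalso; apply: nW0.
    by have := Wlin (- 1) x x Wx Wx; rewrite scaleN1r addNr.
  - by left; rewrite scaler0 add0r.
  - by right; rewrite /= scaler0 addr0.
have WZ c x : W x -> W (c *: x) by move=> Wx; rewrite -[_ *: _]addr0; exact: Wlin.
have WD x y : W x -> W y -> W (x + y).
  by move=> Wx Wy; rewrite -[x]scale1r; exact: Wlin.
have dec x : exists c, W (x - c *: v).
  apply: contrapT => nx.
  have nWx : ~ W x by move=> Wx; apply: nx; exists 0; rewrite scale0r subr0.
  apply: (Wmax [set w + c *: x | w in W & c in [set: K]]%classic).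
    split=> [w Ww|/(_ x)]; first by exists w => //; exists 0 => //; rewrite scale0r addr0.
    by move=> sub; apply/nWx/sub; exists 0 => //; exists 1 => //; rewrite scale1r add0r.
  split=> [[w Ww [c _ wcx]]|c y z [w Ww [d _ <-]] [w' Ww' [d' _ <-]]].
    have [c0|c0] := eqVneq c 0.
      by apply: Wv; rewrite -wcx c0 scale0r addr0.
    apply: nx; exists c^-1.
    rewrite -wcx scalerDr scalerA mulVf// scale1r opprD addrCA subrr addr0 -scaleNr.
    exact: WZ.
  exists (c *: w + w'); first exact: Wlin.
  by exists (c * d + d') => //; rewrite scalerDl -scalerA scalerDr addrACA.
have [f fP] := choice dec.
have uniq x c : W (x - c *: v) -> c = f x.
  move=> Wc; apply/eqP; rewrite -subr_eq0; apply/negPn/negP => cf0.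
  apply: Wv.
  have := WZ (c - f x)^-1 _ (WD _ _ (fP x) (WZ (- 1) _ Wc)).
  have -> : x - f x *: v + - 1 *: (x - c *: v) = (c - f x) *: v.
    by rewrite scaleN1r opprB addrC addrA subrK scalerBl.
  by rewrite scalerA mulVf// scale1r.
exists f => [c x y|]; last by apply/esym/uniq; rewrite scale1r subrr.
apply/esym/uniq.
have -> : c *: x + y - (c *: (f x : K^o) + f y) *: v
        = c *: (x - f x *: v) + (y - f y *: v).
  by rewrite scalerBr scalerDl opprD addrACA scalerA.
exact: Wlin.
Qed.

Section TensAlg.
Variables (K : fieldType) (A B : algType K).
Implicit Types (X Y Z : tens A B).

Let tpl (b : B) : linear (fun a : A => a \ox b).
Proof. exact: (tpure_bilin A B).1. Qed.
Let tpr (a : A) : linear (fun b : B => a \ox b).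
Proof. exact: (tpure_bilin A B).2. Qed.

Definition tens_mul X Y : tens A B :=
  tlift (fun a b => tlift (fun c d => (a * c) \ox (b * d)) Y) X.

Let in_bilin a b : bilin (fun (c : A) (d : B) => (a * c) \ox (b * d)).
Proof.
by split=> [d k c c'|c k d d']; rewrite mulrDr -scalerAr (tpl, tpr).
Qed.

Let out_bilin Y :
  bilin (fun (a : A) (b : B) => tlift (fun c d => (a * c) \ox (b * d)) Y).
Proof.
split=> [b k a a'|a k b b']; elim/tensumW: Y => s; rewrite !tlift_sum//;
  rewrite scaler_sumr -big_split; apply: eq_bigr => p _;
  by rewrite mulrDl -scalerAl (tpl, tpr).
Qed.

Lemma tens_mulE a b c d :
  tens_mul (a \ox b) (c \ox d) = (a * c) \ox (b * d).
Proof. by rewrite /tens_mul !tliftE. Qed.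

Let mull Y : linear (tens_mul^~ Y).
Proof. exact: tlift_linear. Qed.

Let mulr X : linear (tens_mul X).
Proof.
move=> k Y Z; rewrite /tens_mul; elim/tensumW: X => s; rewrite !tlift_sum//.
by rewrite scaler_sumr -big_split; apply: eq_bigr => p _; rewrite (tlift_linear _).
Qed.

Let mulDl : left_distributive tens_mul +%R.
Proof. by move=> X Y Z; have := mull Z 1 X Y; rewrite !scale1r. Qed.
Let mulDr : right_distributive tens_mul +%R.
Proof. by move=> X Y Z; have := mulr X 1 Y Z; rewrite !scale1r. Qed.
Let mul0l Y : tens_mul 0 Y = 0.
Proof. by have := mull Y (- 1) 0 0; rewrite !scaleN1r !addNr. Qed.
Let mul0r X : tens_mul X 0 = 0.
Proof. by have := mulr X (- 1) 0 0; rewrite !scaleN1r !addNr. Qed.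
Let mulZl k X Y : tens_mul (k *: X) Y = k *: tens_mul X Y.
Proof. by have := mull Y k X 0; rewrite !addr0 mul0l addr0. Qed.
Let mulZr k X Y : tens_mul X (k *: Y) = k *: tens_mul X Y.
Proof. by have := mulr X k Y 0; rewrite !addr0 mul0r addr0. Qed.

Let mulA : associative tens_mul.
Proof.
move=> X Y Z; elim/tens_ind: X => [|a b X IH]; first by rewrite !mul0l.
rewrite !mulDl -{}IH; congr (_ + _); elim/tens_ind: Y => [|c d Y IH].
  by rewrite !(mul0l, mul0r).
rewrite !(mulDl, mulDr) -{}IH; congr (_ + _).
elim/tens_ind: Z => [|e f Z IH]; first by rewrite !mul0r.
by rewrite !mulDr -{}IH !tens_mulE !mulrA.
Qed.

Let mul1l : left_id (1 \ox 1) tens_mul.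
Proof.
elim/tens_ind=> [|a b X IH]; first by rewrite mul0r.
by rewrite mulDr IH tens_mulE !mul1r.
Qed.

Let mul1r : right_id (1 \ox 1) tens_mul.
Proof.
elim/tens_ind=> [|a b X IH]; first by rewrite mul0l.
by rewrite mulDl IH tens_mulE !mulr1.
Qed.

Let oner_neq0 : (1 : A) \ox (1 : B) != 0.
Proof.
have [f fl f1] := exists_functional (oner_neq0 A).
have [g gl g1] := exists_functional (oner_neq0 B).
pose h (a : A) (b : B) : K^o := f a * g b.
have hP : bilin h.
  split=> [b k a a'|a k b b']; rewrite /h (fl, gl) ?mulrDl ?mulrDr.
    by rewrite -mulrA.
  by congr (_ + _); rewrite mulrCA.
apply/eqP => /(congr1 (tlift h)); rewrite tliftE// /h f1 g1 mulr1.
have -> : 0 = tensum [::] :> tens A B by [].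
by rewrite tlift_sum// big_nil; apply/eqP; exact: GRing.oner_neq0.
Qed.

HB.instance Definition _ := GRing.Zmodule_isNzRing.Build (tens A B)
  mulA mul1l mul1r mulDl mulDr oner_neq0.
HB.instance Definition _ := GRing.Lmodule_isLalgebra.Build K (tens A B)
  (fun k X Y => esym (mulZl k X Y)).
HB.instance Definition _ := GRing.Lalgebra_isAlgebra.Build K (tens A B)
  (fun k X Y => esym (mulZr k X Y)).

Lemma tpureM (a c : A) (b d : B) :
  (a \ox b) * (c \ox d) = (a * c) \ox (b * d).
Proof. exact: tens_mulE. Qed.

Lemma tens1E : 1 = 1 \ox 1 :> tens A B.
Proof. by []. Qed.

End TensAlg.

Inductive uexp (K : Type) :=
| UCst of K
| UE | UF | UK | UKi
| UAdd of uexp K & uexp K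
| UMul of uexp K & uexp K.
Arguments UE {K}.
Arguments UF {K}.
Arguments UK {K}.
Arguments UKi {K}.

HB.instance Definition _ (K : Type) := gen_eqMixin (uexp K).
HB.instance Definition _ (K : Type) := gen_choiceMixin (uexp K).

(* UK and UKi stand for q^H and q^{-H}. *)
Inductive ueq (K : fieldType) (q : K) : uexp K -> uexp K -> Prop :=
| ueq_refl x : ueq q x x
| ueq_sym x y : ueq q x y -> ueq q y x
| ueq_trans y x z : ueq q x y -> ueq q y z -> ueq q x z
| ueq_add x x' y y' :
    ueq q x x' -> ueq q y y' -> ueq q (UAdd x y) (UAdd x' y')
| ueq_mul x x' y y' :
    ueq q x x' -> ueq q y y' -> ueq q (UMul x y) (UMul x' y')
| ueq_addA x y z : ueq q (UAdd x (UAdd y z)) (UAdd (UAdd x y) z)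
| ueq_addC x y : ueq q (UAdd x y) (UAdd y x)
| ueq_add0 x : ueq q (UAdd (UCst 0) x) x
| ueq_addN x : ueq q (UAdd (UMul (UCst (- 1)) x) x) (UCst 0)
| ueq_mulA x y z : ueq q (UMul x (UMul y z)) (UMul (UMul x y) z)
| ueq_mul1l x : ueq q (UMul (UCst 1) x) x
| ueq_mulDl x y z : ueq q (UMul (UAdd x y) z) (UAdd (UMul x z) (UMul y z))
| ueq_mulDr x y z : ueq q (UMul x (UAdd y z)) (UAdd (UMul x y) (UMul x z))
| ueq_cstD a b : ueq q (UCst (a + b)) (UAdd (UCst a) (UCst b))
| ueq_cstM a b : ueq q (UCst (a * b)) (UMul (UCst a) (UCst b))
| ueq_cstC a x : ueq q (UMul (UCst a) x) (UMul x (UCst a))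
| ueq_KKi : ueq q (UMul UK UKi) (UCst 1)
| ueq_KiK : ueq q (UMul UKi UK) (UCst 1)
| ueq_KE : ueq q (UMul UK UE) (UMul (UCst q) (UMul UE UK))
| ueq_KF : ueq q (UMul UK UF) (UMul (UCst q^-1) (UMul UF UK))
| ueq_EF : ueq q
    (UAdd (UMul UE UF) (UMul (UCst (- 1)) (UMul UF UE)))
    (UMul (UCst (q - q^-1)^-1)
       (UAdd (UMul UK UK) (UMul (UCst (- 1)) (UMul UKi UKi)))).

Definition urels (K : fieldType) (q : K) (A : algType K) (e f k ki : A) :=
  [/\ k * ki = 1, ki * k = 1, k * e = q *: (e * k), k * f = q^-1 *: (f * k)
    & e * f - f * e = (q - q^-1)^-1 *: (k ^+ 2 - ki ^+ 2)].

Fixpoint ueval (K : fieldType) (A : algType K) (e f k ki : A) (x : uexp K)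
    : A :=
  match x with
  | UCst c => c%:A
  | UE => e
  | UF => f
  | UK => k
  | UKi => ki
  | UAdd x y => ueval e f k ki x + ueval e f k ki y
  | UMul x y => ueval e f k ki x * ueval e f k ki y
  end.

Lemma ueval_eq (K : fieldType) (q : K) (A : algType K) (e f k ki : A) x y :
  urels q e f k ki -> ueq q x y -> ueval e f k ki x = ueval e f k ki y.
Proof.
case=> kki kik ke kf ef.
elim=> {x y} //=.
- by move=> x y z _ -> _ ->.
- by move=> x x' y y' _ -> _ ->.
- by move=> x x' y y' _ -> _ ->.
- by move=> x y z; rewrite addrA.
- by move=> x y; rewrite addrC.
- by move=> x; rewrite scale0r add0r.
- by move=> x; rewrite scale0r -scalerAl mul1r scaleN1r addNr.
- by move=> x y z; rewrite mulrA.
- by move=> x; rewrite scale1r mul1r.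
- by move=> x y z; rewrite mulrDl.
- by move=> x y z; rewrite mulrDr.
- by move=> a b; rewrite scalerDl.
- by move=> a b; rewrite -scalerAl mul1r scalerA.
- by move=> a x; rewrite -scalerAl mul1r -scalerAr mulr1.
- by rewrite scale1r.
- by rewrite scale1r.
- by rewrite -scalerAl mul1r.
- by rewrite -scalerAl mul1r.
- by rewrite -!scalerAl !mul1r !scaleN1r ef !expr2.
Qed.

Section Uq.
Variables (K : fieldType) (q : K).

Definition ueqb (x y : uexp K) := `[< ueq q x y >].

Lemma ueqb_equiv : equiv_class_of ueqb.
Proof.
split=> [x|x y|y x z]; first by apply/asboolP; constructor.
  by apply/asboolP/asboolP; exact: ueq_sym.
by move=> /asboolP xy /asboolP yz; apply/asboolP; exact: ueq_trans xy yz.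
Qed.

Canonical ueqb_equivrel := EquivRelPack ueqb_equiv.

Definition Uq := {eq_quot ueqb_equivrel}.
HB.instance Definition _ := Choice.on Uq.
HB.instance Definition _ := EqQuotient.on Uq.

Definition uclass (x : uexp K) : Uq := \pi_Uq x.

Lemma uclassP (x y : uexp K) : ueq q x y <-> uclass x = uclass y.
Proof. by split=> [xy|/eqmodP/asboolP//]; apply/eqmodP/asboolP. Qed.

Lemma uclass_repr X : uclass (repr X) = X.
Proof. exact: reprK. Qed.

Lemma repr_uclass x : ueq q (repr (uclass x)) x.
Proof. by apply/uclassP; rewrite uclass_repr. Qed.

Lemma uclassW (P : Uq -> Prop) : (forall x, P (uclass x)) -> forall X, P X.
Proof. by move=> Px X; rewrite -[X]uclass_repr. Qed.

Definition uq_add (X Y : Uq) := uclass (UAdd (repr X) (repr Y)).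
Definition uq_mul (X Y : Uq) := uclass (UMul (repr X) (repr Y)).
Definition uq_scale (c : K) (X : Uq) := uclass (UMul (UCst c) (repr X)).
Definition uq_opp (X : Uq) := uq_scale (- 1) X.

Let addE x y : uq_add (uclass x) (uclass y) = uclass (UAdd x y).
Proof. by apply/uclassP/ueq_add; exact: repr_uclass. Qed.

Let mulE x y : uq_mul (uclass x) (uclass y) = uclass (UMul x y).
Proof. by apply/uclassP/ueq_mul; exact: repr_uclass. Qed.

Let scaleE c x : uq_scale c (uclass x) = uclass (UMul (UCst c) x).
Proof. by apply/uclassP/ueq_mul; [exact: ueq_refl | exact: repr_uclass]. Qed.

Let addA : associative uq_add.
Proof.
elim/uclassW=> x; elim/uclassW=> y; elim/uclassW=> z.
by rewrite !addE; apply/uclassP; exact: ueq_addA.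
Qed.

Let addC : commutative uq_add.
Proof.
elim/uclassW=> x; elim/uclassW=> y.
by rewrite !addE; apply/uclassP; exact: ueq_addC.
Qed.

Let add0 : left_id (uclass (UCst 0)) uq_add.
Proof. by elim/uclassW=> x; rewrite addE; apply/uclassP; exact: ueq_add0. Qed.

Let addN : left_inverse (uclass (UCst 0)) uq_opp uq_add.
Proof.
elim/uclassW=> x; rewrite /uq_opp scaleE addE.
by apply/uclassP; exact: ueq_addN.
Qed.

HB.instance Definition _ := GRing.isZmodule.Build Uq addA addC add0 addN.

Let mulA : associative uq_mul.
Proof.
elim/uclassW=> x; elim/uclassW=> y; elim/uclassW=> z.
by rewrite !mulE; apply/uclassP; exact: ueq_mulA.
Qed.

Let mul1l : left_id (uclass (UCst 1)) uq_mul.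
Proof. by elim/uclassW=> x; rewrite mulE; apply/uclassP; exact: ueq_mul1l. Qed.

Let mul1r : right_id (uclass (UCst 1)) uq_mul.
Proof.
elim/uclassW=> x; rewrite mulE; apply/uclassP.
exact: ueq_trans (ueq_sym (ueq_cstC _ _ _)) (ueq_mul1l _ _).
Qed.

Let mulDl : left_distributive uq_mul +%R.
Proof.
elim/uclassW=> x; elim/uclassW=> y; elim/uclassW=> z.
by rewrite /+%R/= !(mulE, addE); apply/uclassP; exact: ueq_mulDl.
Qed.

Let mulDr : right_distributive uq_mul +%R.
Proof.
elim/uclassW=> x; elim/uclassW=> y; elim/uclassW=> z.
by rewrite /+%R/= !(mulE, addE); apply/uclassP; exact: ueq_mulDr.
Qed.

(* Seen through the trivial representation E, F |-> 0 and q^H |-> 1. *)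
Let oner_neq0 : uclass (UCst 1) != 0.
Proof.
apply/eqP => /uclassP /(@ueval_eq _ q K^o 0 0 1 1) /=.
rewrite scale1r scale0r => /(_ _)/wrap[|/eqP]; last by rewrite GRing.oner_eq0.
by split; rewrite ?(mul1r, mulr1, mul0r, mulr0, scaler0, expr1n, subrr).
Qed.

HB.instance Definition _ := GRing.Zmodule_isNzRing.Build Uq
  mulA mul1l mul1r mulDl mulDr oner_neq0.

Let scaleA c d X : uq_scale c (uq_scale d X) = uq_scale (c * d) X.
Proof.
elim/uclassW: X => x; rewrite !scaleE; apply/uclassP.
apply: ueq_trans (ueq_mulA _ _ _ _) (ueq_mul _ (ueq_refl _ _)).
exact: ueq_sym (ueq_cstM _ _ _).
Qed.

Let scale1 : left_id 1 uq_scale.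
Proof.
by elim/uclassW=> x; rewrite scaleE; apply/uclassP; exact: ueq_mul1l.
Qed.

Let scaleDr : right_distributive uq_scale +%R.
Proof.
move=> c; elim/uclassW=> x; elim/uclassW=> y.
by rewrite /+%R/= !(scaleE, addE); apply/uclassP; exact: ueq_mulDr.
Qed.

Let scaleDl X : {morph uq_scale^~ X : c d / c + d}.
Proof.
move=> c d; elim/uclassW: X => x; rewrite [in RHS]/+%R/= !(scaleE, addE).
apply/uclassP; apply: ueq_trans (ueq_mulDl _ _ _ _).
exact: ueq_mul (ueq_cstD _ _ _) (ueq_refl _ _).
Qed.

HB.instance Definition _ := GRing.Zmodule_isLmodule.Build K Uq
  scaleA scale1 scaleDr scaleDl.

Let scaleAl c (X Y : Uq) : c *: (X * Y) = c *: X * Y.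
Proof.
elim/uclassW: X => x; elim/uclassW: Y => y.
by rewrite /*%R/= /( *:%R)/= !(scaleE, mulE); apply/uclassP; exact: ueq_mulA.
Qed.

Let scaleAr c (X Y : Uq) : c *: (X * Y) = X * (c *: Y).
Proof.
elim/uclassW: X => x; elim/uclassW: Y => y.
rewrite /*%R/= /( *:%R)/= !(scaleE, mulE); apply/uclassP.
apply: ueq_trans (ueq_mulA _ _ _ _) _.
apply: ueq_trans (ueq_sym (ueq_mulA _ _ _ _)).
exact: ueq_mul (ueq_cstC _ _ _) (ueq_refl _ _).
Qed.

HB.instance Definition _ := GRing.Lmodule_isLalgebra.Build K Uq scaleAl.
HB.instance Definition _ := GRing.Lalgebra_isAlgebra.Build K Uq scaleAr.

Definition uE : Uq := uclass UE.
Definition uF : Uq := uclass UF.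
Definition uK : Uq := uclass UK.
Definition uKi : Uq := uclass UKi.

Lemma uclassC c : uclass (UCst c) = c%:A.
Proof.
rewrite /( *:%R)/= scaleE -[c in LHS]mulr1.
by apply/uclassP; exact: ueq_cstM.
Qed.

Lemma uclassD x y : uclass (UAdd x y) = uclass x + uclass y.
Proof. by rewrite -addE. Qed.

Lemma uclassM x y : uclass (UMul x y) = uclass x * uclass y.
Proof. by rewrite -mulE. Qed.

Lemma uclassZ c x : uclass (UMul (UCst c) x) = c *: uclass x.
Proof. by rewrite [RHS]scaleE. Qed.

Lemma Uq_rels : urels q uE uF uK uKi.
Proof.
split.
- by rewrite -uclassM; apply/uclassP; exact: ueq_KKi.
- by rewrite -uclassM; apply/uclassP; exact: ueq_KiK.
- by rewrite -!uclassM -uclassZ; apply/uclassP; exact: ueq_KE.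
- by rewrite -!uclassM -uclassZ; apply/uclassP; exact: ueq_KF.
- rewrite !expr2 -![- (_ * _)]scaleN1r -!uclassM -!(uclassZ (- 1)) -!uclassD.
  rewrite -uclassZ.
  by apply/uclassP; exact: ueq_EF.
Qed.

Lemma Uq_ind (P : Uq -> Prop) :
  P uE -> P uF -> P uK -> P uKi -> (forall c, P c%:A) ->
  (forall X Y, P X -> P Y -> P (X + Y)) ->
  (forall X Y, P X -> P Y -> P (X * Y)) -> forall X, P X.
Proof.
move=> PE PF PK PKi PC PD PM; elim/uclassW; elim=> // [c|x Px y Py|x Px y Py].
- by rewrite uclassC.
- by rewrite uclassD; exact: PD.
- by rewrite uclassM; exact: PM.
Qed.

(* The algebra morphism Uq -> A sending the generators to e, f, k, ki; it does
   not depend on the chosen representative when the relations hold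
   (ulift_class, ulift_monoid). *)
Definition ulift (A : algType K) (e f k ki : A) (X : Uq) : A :=
  ueval e f k ki (repr X).

Section Lift.
Variables (A : algType K) (e f k ki : A).
Hypothesis rels : urels q e f k ki.

Lemma ulift_class x : ulift e f k ki (uclass x) = ueval e f k ki x.
Proof. by apply: ueval_eq rels _; exact: repr_uclass. Qed.

Lemma uliftE : [/\ ulift e f k ki uE = e, ulift e f k ki uF = f,
  ulift e f k ki uK = k & ulift e f k ki uKi = ki].
Proof. by split; rewrite ulift_class. Qed.

Lemma ulift_linear : linear (ulift e f k ki).
Proof.
move=> c; elim/uclassW=> x; elim/uclassW=> y.
rewrite -uclassZ -uclassD.
by rewrite !ulift_class /= -scalerAl GRing.mul1r.
Qed.

Lemma ulift_monoid : monoid_morphism (ulift e f k ki).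
Proof.
split=> [|X Y].
  by rewrite -[1]scale1r -uclassC ulift_class /= scale1r.
elim/uclassW: X => x; elim/uclassW: Y => y.
by rewrite -uclassM !ulift_class.
Qed.

End Lift.
End Uq.

Section TensTheory.
Variables (K : fieldType) (A B : algType K).

Lemma tpureDl (a a' : A) (b : B) : (a + a') \ox b = a \ox b + a' \ox b.
Proof. by have := (tpure_bilin A B).1 b 1 a a'; rewrite !scale1r. Qed.

Lemma tpureDr (a : A) (b b' : B) : a \ox (b + b') = a \ox b + a \ox b'.
Proof. by have := (tpure_bilin A B).2 a 1 b b'; rewrite !scale1r. Qed.

Lemma tpure0l (b : B) : (0 : A) \ox b = 0.
Proof. by apply: (addrI (0 \ox b)); rewrite -tpureDl !addr0. Qed.

Lemma tpure0r (a : A) : a \ox (0 : B) = 0.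
Proof. by apply: (addrI (a \ox 0)); rewrite -tpureDr !addr0. Qed.

Lemma tpureZl c (a : A) (b : B) : (c *: a) \ox b = c *: (a \ox b).
Proof.
by have := (tpure_bilin A B).1 b c a 0; rewrite /= !addr0 tpure0l addr0.
Qed.

Lemma tpureZr c (a : A) (b : B) : a \ox (c *: b) = c *: (a \ox b).
Proof.
by have := (tpure_bilin A B).2 a c b 0; rewrite /= !addr0 tpure0r addr0.
Qed.

End TensTheory.

Section Hopf.
Variables (K : fieldType) (q : K).
Local Notation U := (Uq q).
Local Notation E := (uE q).
Local Notation F := (uF q).
Local Notation k := (uK q).
Local Notation k' := (uKi q).

Definition Delta : U -> tens U U :=
  ulift (E \ox k' + k \ox E) (F \ox k' + k \ox F) (k \ox k) (k' \ox k').

Definition casimir : U :=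
  - ((q - q^-1) ^+ 2 / (q + q^-1)) *:
    (F * E + ((q - q^-1) ^+ 2)^-1 *: (q *: k ^+ 2 + q^-1 *: k' ^+ 2)).

Local Notation U3 := (tens (tens U U) U).

Definition Delta_id : tens U U -> U3 := tlift (fun x y => Delta x \ox y).

Definition slot13 : tens U U -> U3 := tlift (fun x y => x \ox 1 \ox y).

Definition casimir13 : U3 := slot13 (Delta casimir).

Definition centralizer3 (X : U3) :=
  forall x : U, Delta_id (Delta x) * X - X * Delta_id (Delta x) = 0.

End Hopf.

Lemma Delta_rels (K : fieldType) (q : K) : q != 0 ->
  let E := uE q in let F := uF q in let k := uK q in let k' := uKi q in
  urels q (E \ox k' + k \ox E) (F \ox k' + k \ox F) (k \ox k) (k' \ox k').
Proof.
move=> q0 E F k k'.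
have [kk' k'k kE kF EF] := Uq_rels q; rewrite -/E -/F -/k -/k' in kk' k'k kE kF EF.
have k'E : k' * E = q^-1 *: (E * k').
  rewrite -[E in LHS]mulr1 -kk' 2!mulrA -[k' * E * k]mulrA.
  rewrite -[E * k](scalerK q0) -kE -scalerAr -scalerAl mulrA.
  by rewrite k'k mul1r.
have k'F : k' * F = q *: (F * k').
  rewrite -[F in LHS]mulr1 -kk' 2!mulrA -[k' * F * k]mulrA.
  have q'0 : q^-1 != 0 by rewrite invr_eq0.
  rewrite -[F * k](scalerK q'0) -kF invrK -scalerAr -scalerAl mulrA.
  by rewrite k'k mul1r.
split.
- by rewrite tpureM kk'.
- by rewrite tpureM k'k.
- rewrite mulrDl mulrDr !tpureM scalerDr kE kk' k'k.
  by rewrite tpureZl tpureZr.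
- rewrite mulrDl mulrDr !tpureM scalerDr kF kk' k'k.
  by rewrite tpureZl tpureZr.
rewrite !mulrDl !mulrDr !tpureM kE kF k'E k'F !(tpureZl, tpureZr).
have -> : E * F = F * E + (q - q^-1)^-1 *: (k ^+ 2 - k' ^+ 2).
  by rewrite -EF addrC subrK.
set z := (q - q^-1)^-1; rewrite !expr2 !tpureM.
rewrite tpureDl tpureDr !tpureZl !tpureZr -!scaleN1r.
rewrite tpureDl tpureDr !tpureZl !tpureZr !scaleN1r.
set a := F * E \ox _; set b := q *: _; set c := q^-1 *: _.
set d := k * k \ox (F * E); set x := k * k \ox (k' * k').
set y := k' * k' \ox _; set t := k * k \ox _.
rewrite !scalerDr !scalerN -addrA -[a + _ + _]addrA opprD [X in _ = X]addrC.
rewrite !opprD !addrA.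
rewrite [LHS](ACl ((3*7)*(1*9)*(2*8)*(4*11)*(5*10)*(6*12)))/=.
by rewrite !subrr !addr0.
Qed.

Section Modules.
Variables (K : fieldType) (q s : K).
Local Notation U := (Uq q).

Definition qint (k : nat) : K := (q ^+ k - q ^- k) / (q - q^-1).

Lemma qint0 : qint 0 = 0.
Proof. by rewrite /qint expr0 invr1 subrr mul0r. Qed.

Definition qfact (n : nat) : K := \prod_(1 <= k < n.+1) qint k.

(* The basis v_0, ..., v_n of V_n consists of weight vectors, v_0 being the
   highest weight vector, and matrices act on column vectors:
     q^H v_j = q^(n/2 - j) v_j, E v_j = [n - j + 1] v_(j-1),
     F v_j = [j + 1] v_(j+1), where s = q^(1/2).
   wt n j is twice the exponent n/2 - j. *)
Definition wt (n i : nat) : int := n%:Z - (2 * i)%:Z.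

Definition mxE_ n : 'M[K]_n.+1 :=
  \matrix_(i, j) (if i.+1 == j :> nat then qint (n - i) else 0).
Definition mxF_ n : 'M[K]_n.+1 :=
  \matrix_(i, j) (if i == j.+1 :> nat then qint i else 0).
Definition mxK_ n : 'M[K]_n.+1 := diag_mx (\row_j s ^ wt n j).
Definition mxKi_ n : 'M[K]_n.+1 := diag_mx (\row_j s ^ (- wt n j)).

Definition rho n : U -> 'M[K]_n.+1 :=
  ulift (mxE_ n) (mxF_ n) (mxK_ n) (mxKi_ n).

Lemma rho_rels n : s != 0 -> s ^+ 2 = q ->
  urels q (mxE_ n) (mxF_ n) (mxK_ n) (mxKi_ n).
Proof.
move=> s0 s2; have q0 : q != 0 by rewrite -s2 expf_neq0.
have sw2 (i j : nat) : j = i.+1 -> s ^ wt n i = q * s ^ wt n j.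
  by move=> ->; rewrite -s2 exprnP -expfzDr// /wt; congr (s ^ _); lia.
split.
- rewrite /GRing.mul/= mulmx_diag -[RHS]diag_const_mx; congr diag_mx.
  by apply/rowP => j; rewrite !mxE -expfzDr// subrr expr0z.
- rewrite /GRing.mul/= mulmx_diag -[RHS]diag_const_mx; congr diag_mx.
  by apply/rowP => j; rewrite !mxE -expfzDr// addNr expr0z.
- rewrite /GRing.mul/= mul_diag_mx mul_mx_diag.
  apply/matrixP => i j; rewrite !mxE. case: eqP => [/esym ij|_]; last first.
    by rewrite mul0r !mulr0.
  by rewrite (sw2 _ _ ij) -mulrA [X in _ = _ * X]mulrC.
- rewrite /GRing.mul/= mul_diag_mx mul_mx_diag.
  apply/matrixP => i j; rewrite !mxE; case: eqP => [ij|_]; last first.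
    by rewrite mul0r !mulr0.
  by rewrite (sw2 _ _ ij) [RHS]mulrCA mulKf// mulrC.
have EF (i j : 'I_n.+1) : (mxE_ n *m mxF_ n) i j =
    if i == j then qint (n - i) * qint i.+1 else 0.
  rewrite mxE; case: (ltnP i n) => [ilt|ige]; last first.
    have -> : (n - i = 0)%N by lia.
    rewrite qint0 mul0r if_same big1// => k _.
    by rewrite !mxE; case: eqP => ik; rewrite ?mul0r//; have := ltn_ord k; lia.
  rewrite (bigD1 (Ordinal (ilt : (i.+1 < n.+1)%N)))//= big1 => [|k /eqP ki].
    rewrite !mxE/= eqxx addr0 eqSS -(inj_eq val_inj); case: eqP => //.
    by rewrite mulr0.
  rewrite !mxE; case: eqP => ik; last by rewrite mul0r.
  by exfalso; apply: ki; apply: val_inj.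
have FE (i j : 'I_n.+1) : (mxF_ n *m mxE_ n) i j =
    if i == j then qint i * qint (n - i).+1 else 0.
  rewrite mxE; case: (posnP i) => [i0|ipos].
    rewrite i0 qint0 mul0r if_same big1// => k _.
    by rewrite !mxE i0 mul0r.
  have ip : (i.-1 < n.+1)%N by have := ltn_ord i; lia.
  rewrite (bigD1 (Ordinal ip))//= big1 => [|k /eqP ki].
    rewrite !mxE/= prednK// eqxx addr0 -(inj_eq val_inj); case: eqP => //.
      by move=> _; congr (_ * qint _); have := ltn_ord i; lia.
    by rewrite mulr0.
  rewrite !mxE; case: eqP => ik; last by rewrite mul0r.
  by exfalso; apply: ki; apply: val_inj => /=; rewrite ik.
rewrite !expr2 -!mulmxE !mulmx_diag; apply/matrixP => i j.
rewrite mxE EF mxE FE !mxE -(inj_eq val_inj) /=.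
case: eqP => ij; last by rewrite !mulr0n !subrr mulr0.
rewrite !mulr1n -!expfzDr//.
have le_in : (i <= n)%N by rewrite -ltnS.
have sE m : s ^ (2 * m)%:Z = q ^+ m by rewrite -exprnP exprM s2.
have -> : wt n i + wt n i = (2 * (n - i))%:Z - (2 * i)%:Z by rewrite /wt; lia.
have -> : - wt n i - wt n i = (2 * i)%:Z - (2 * (n - i))%:Z.
  by rewrite /wt; lia.
rewrite !expfzDr// -!invr_expz !sE /qint !exprS.
have : q ^+ i != 0 by rewrite expf_neq0.
have : q ^+ (n - i) != 0 by rewrite expf_neq0.
move: (q ^+ (n - i)) (q ^+ i) => b a b0 a0.
have [d0|d0] := eqVneq (q - q^-1) 0; first by rewrite d0 invr0 !(mulr0, mul0r) subrr.
have d0' : q * q - 1 != 0.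
  by apply: contra_neq d0 => qq; apply: (mulfI q0); rewrite mulrBr divff// mulr0.
by field; rewrite q0 a0 b0.
Qed.

Section Rho.
Hypotheses (s0 : s != 0) (s2 : s ^+ 2 = q).

Lemma rho_linear n : linear (rho n).
Proof. exact: ulift_linear (rho_rels n s0 s2). Qed.

Lemma rho_monoid n : monoid_morphism (rho n).
Proof. exact: ulift_monoid (rho_rels n s0 s2). Qed.

End Rho.

Definition rep2 n1 n2 : tens U U -> 'M[K]_(n1.+1 * n2.+1) :=
  tlift (fun x y => rho n1 x *t rho n2 y).

Definition rep3 n1 n2 n3 :
    tens (tens U U) U -> 'M[K]_(n1.+1 * n2.+1 * n3.+1) :=
  tlift (fun X z => rep2 n1 n2 X *t rho n3 z).

End Modules.

(* The completions prod End (V_n1 (x) V_n2) and prod End (V_n1 (x) V_n2 (x) V_n3)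
   of U^{(x) 2} and U^{(x) 3}; endomorphisms are matrices in the lexicographically
   ordered tensor products of the bases of the V_n (see mxtens). *)
Definition Uhat2 (K : fieldType) := forall n1 n2, 'M[K]_(n1.+1 * n2.+1).
Definition Uhat3 (K : fieldType) :=
  forall n1 n2 n3, 'M[K]_(n1.+1 * n2.+1 * n3.+1).

Section Completion.
Variable K : fieldType.

Definition hat_mul (X Y : Uhat3 K) : Uhat3 K :=
  fun n1 n2 n3 => X n1 n2 n3 *m Y n1 n2 n3.

(* Only used for R and its flip, which are invertible: Rmx_unit, Rtmx_unit. *)
Definition hat_inv (X : Uhat3 K) : Uhat3 K :=
  fun n1 n2 n3 => invmx (X n1 n2 n3).

Definition slot12 (X : Uhat2 K) : Uhat3 K :=
  fun n1 n2 n3 => X n1 n2 *t 1%:M.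

Definition slot23 (X : Uhat2 K) : Uhat3 K := fun n1 n2 n3 =>
  castmx (mulnA n1.+1 n2.+1 n3.+1, mulnA n1.+1 n2.+1 n3.+1)
    (1%:M *t X n2 n3).

Variables q s : K.
Local Notation U := (Uq q).

Definition to_hat3 (X : tens (tens U U) U) : Uhat3 K :=
  fun n1 n2 n3 => rep3 s n1 n2 n3 X.

(* q^{2 (H (x) H)}: on a tensor product of vectors of weights q^m and q^m',
   where m = wt n1 i / 2 and m' = wt n2 j / 2, it is q^(2 m m'). *)
Definition qHH : Uhat2 K := fun n1 n2 => diag_mx (\row_k
  let ij := mxtens_unindex k in s ^ (wt n1 ij.1 * wt n2 ij.2)).

Definition qcoef (n : nat) : K :=
  (q - q^-1) ^+ n / qfact q n * q ^+ (n * n.-1)./2.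

(* The series is finite on V_n1 (x) V_n2 since E and F act on V_n1 by matrices
   whose power n1 + 1 is zero: see qseries_stable, EK_nilpotent, FK_nilpotent. *)
Definition qseries (X : tens U U) : Uhat2 K := fun n1 n2 =>
  \sum_(n < n1.+1) qcoef n *: rep2 s n1 n2 X ^+ n.

Definition Rmx : Uhat2 K := fun n1 n2 =>
  qHH n1 n2 *m qseries ((uE q * uK q) \ox (uKi q * uF q)) n1 n2.

(* This is R_21: see Rtmx_flip. *)
Definition Rtmx : Uhat2 K := fun n1 n2 =>
  qseries ((uF q * uK q) \ox (uKi q * uE q)) n1 n2 *m qHH n1 n2.

End Completion.

Section Nilpotent.
Variable K : fieldType.

Lemma strict_upper_nilpotent n (A : 'M[K]_n.+1) :
  (forall i j : 'I_n.+1, (j <= i)%N -> A i j = 0) -> A ^+ n.+1 = 0.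
Proof.
move=> A0.
have Ak k (i j : 'I_n.+1) : (j < i + k)%N -> (A ^+ k) i j = 0.
  elim: k i j => [|k IH] i j lt_ji.
    by rewrite expr0 mxE; case: eqP => // ij; move: lt_ji; rewrite ij; lia.
  rewrite exprS -mulmxE mxE big1// => l _.
  case: (leqP l i) => li; first by rewrite A0// mul0r.
  by rewrite IH ?mulr0//; lia.
by apply/matrixP => i j; rewrite Ak ?mxE//; have := ltn_ord j; lia.
Qed.

Lemma expmx_tens m n (A : 'M[K]_m) (B : 'M[K]_n) k :
  (A *t B) ^+ k = (A ^+ k) *t (B ^+ k).
Proof.
elim: k => [|k IH]; last by rewrite !exprS IH -[LHS]/(_ *m _) tensmx_mul.
rewrite !expr0; apply/matrixP => i j.
case: (mxtens_indexP i) => i1 i2; case: (mxtens_indexP j) => j1 j2.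
rewrite tensmxE !mxE -natrM mulnb (can_eq (@mxtens_indexK _ _)).
by rewrite xpair_eqE.
Qed.

Lemma unitmx_poly_nilpotent m N (X : 'M[K]_m) (c : nat -> K) :
  c 0 = 1 -> X ^+ N = 0 -> \sum_(k < N.+1) c k *: X ^+ k \in unitmx.
Proof.
move=> c0 XN.
pose Y := \sum_(k < N) c k.+1 *: X ^+ k.
have XY : GRing.comm X Y.
  apply: commr_sum => k _; rewrite /GRing.comm -[LHS]/(_ *m _) -[RHS]/(_ *m _).
  by rewrite -scalemxAr -scalemxAl; congr (_ *: _); exact: commrX.
have -> : \sum_(k < N.+1) c k *: X ^+ k = 1 + X * Y.
  rewrite big_ord_recl c0 scale1r; congr (_ + _).
  rewrite mulr_sumr; apply: eq_bigr => k _.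
  by rewrite -[RHS]/(_ *m _) -scalemxAr lift0 exprS.
pose Z := - (X * Y).
have ZN : Z ^+ N = 0.
  by rewrite exprNn exprMn_comm// XN mul0r mulr0.
have /(congr1 -%R) := subrX1 Z N.
rewrite ZN sub0r opprK -mulNr opprB opprK => eq1.
by have [] := mulmx1_unit (esym eq1).
Qed.

End Nilpotent.

Section WellDefined.
Variables (K : fieldType) (q s : K).
Hypotheses (s0 : s != 0) (s2 : s ^+ 2 = q).
Local Notation U := (Uq q).

Lemma tensmx_linear (V : lmodType K) m n p r (f : V -> 'M[K]_(m, n))
    (B : 'M[K]_(p, r)) : linear f -> linear (fun x => f x *t B).
Proof.
move=> fl c x y; apply/matrixP => i j.
by rewrite fl !mxE mulrDl mulrA.
Qed.

Lemma tensmx_linearr (V : lmodType K) m n p r (A : 'M[K]_(m, n))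
    (f : V -> 'M[K]_(p, r)) : linear f -> linear (fun x => A *t f x).
Proof.
move=> fl c x y; apply/matrixP => i j.
by rewrite fl !mxE mulrDr mulrCA.
Qed.

Lemma rep2_bilin n1 n2 : bilin (fun x y : U => rho s n1 x *t rho s n2 y).
Proof.
by split=> x; [apply: tensmx_linear | apply: tensmx_linearr]; exact: rho_linear.
Qed.

Lemma rep2E n1 n2 (x y : U) : rep2 s n1 n2 (x \ox y) = rho s n1 x *t rho s n2 y.
Proof. exact: tliftE (rep2_bilin n1 n2) _ _. Qed.

Lemma rep2_linear n1 n2 : linear (@rep2 K q s n1 n2).
Proof. exact: tlift_linear (rep2_bilin n1 n2). Qed.

Lemma rep3_bilin n1 n2 n3 :
  bilin (fun (X : tens U U) (z : U) => rep2 s n1 n2 X *t rho s n3 z).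
Proof.
split=> x; [apply: tensmx_linear | apply: tensmx_linearr].
  exact: rep2_linear.
exact: rho_linear.
Qed.

Lemma rep3E n1 n2 n3 (X : tens U U) (z : U) :
  rep3 s n1 n2 n3 (X \ox z) = rep2 s n1 n2 X *t rho s n3 z.
Proof. exact: tliftE (rep3_bilin n1 n2 n3) _ _. Qed.

Lemma rep3_linear n1 n2 n3 : linear (@rep3 K q s n1 n2 n3).
Proof. exact: tlift_linear (rep3_bilin n1 n2 n3). Qed.

Lemma tlift_monoid m n (A B : algType K) (f : A -> 'M[K]_m) (g : B -> 'M[K]_n) :
  bilin (fun x y => f x *t g y) -> monoid_morphism f -> monoid_morphism g ->
  monoid_morphism (tlift (fun x y => f x *t g y) : tens A B -> 'M[K]_(m * n)).
Proof.
move=> fg [f1 fM] [g1 gM]; set h := tlift _.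
have hl : linear h := tlift_linear fg.
have hE x y : h (x \ox y) = f x *t g y by exact: tliftE fg _ _.
have h0 : h 0 = 0 by have := hl (- 1) 0 0; rewrite !scaleN1r !addNr.
have hD X Y : h (X + Y) = h X + h Y by have := hl 1 X Y; rewrite !scale1r.
split=> [|X Y].
  by rewrite [1]tens1E hE f1 g1 -[RHS](expr0 (0 *t 0)) expmx_tens !expr0.
elim/tens_ind: X => [|a b X IH]; first by rewrite mul0r h0 mul0r.
rewrite mulrDl !hD mulrDl -IH; congr (_ + _).
elim/tens_ind: Y {IH} => [|c d Y IH]; first by rewrite mulr0 h0 mulr0.
rewrite mulrDr !hD mulrDr -IH; congr (_ + _).
by rewrite tpureM !hE fM gM -[RHS]/(_ *m _) tensmx_mul.
Qed.

Lemma rep2_monoid n1 n2 : monoid_morphism (@rep2 K q s n1 n2).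
Proof. by apply: tlift_monoid (rep2_bilin _ _) _ _; exact: rho_monoid. Qed.

Lemma rep3_monoid n1 n2 n3 : monoid_morphism (@rep3 K q s n1 n2 n3).
Proof.
apply: tlift_monoid (rep3_bilin _ _ _) _ _; last exact: rho_monoid.
exact: rep2_monoid.
Qed.

Lemma rho_gens n : [/\ rho s n (uE q) = mxE_ q n, rho s n (uF q) = mxF_ q n,
  rho s n (uK q) = mxK_ s n & rho s n (uKi q) = mxKi_ s n].
Proof. exact: uliftE (rho_rels n s0 s2). Qed.

Lemma EK_nilpotent n1 n2 :
  rep2 s n1 n2 ((uE q * uK q) \ox (uKi q * uF q)) ^+ n1.+1 = 0.
Proof.
have [rE rF rK rKi] := rho_gens n1; have [_ rM] := rho_monoid s0 s2 n1.
rewrite rep2E expmx_tens rM rE rK strict_upper_nilpotent ?tens0mx// => i j ij.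
rewrite -mulmxE mul_mx_diag !mxE; case: eqP => [eij|]; last by rewrite mul0r.
by move: ij; rewrite -eij ltnn.
Qed.

Lemma FK_nilpotent n1 n2 :
  rep2 s n1 n2 ((uF q * uK q) \ox (uKi q * uE q)) ^+ n1.+1 = 0.
Proof.
have [rE rF rK rKi] := rho_gens n1; have [_ rM] := rho_monoid s0 s2 n1.
rewrite rep2E expmx_tens rM rF rK.
have trX (A : 'M[K]_n1.+1) k : A ^+ k = ((A^T) ^+ k)^T.
  elim: k => [|k IH]; first by rewrite !expr0 trmx1.
  by rewrite exprS exprSr IH -!mulmxE trmx_mul trmxK.
rewrite trX strict_upper_nilpotent ?trmx0 ?tens0mx// => i j ij.
rewrite mxE -mulmxE mul_mx_diag !mxE; case: eqP => [eij|]; last by rewrite mul0r.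
by move: ij; rewrite eij ltnn.
Qed.

Lemma qseries_stable (X : tens U U) n1 n2 N : (n1 < N)%N ->
  rep2 s n1 n2 X ^+ n1.+1 = 0 ->
  \sum_(n < N) qcoef q n *: rep2 s n1 n2 X ^+ n = qseries s X n1 n2.
Proof.
move=> lt_nN X0; rewrite /qseries -(subnKC lt_nN) big_split_ord /=.
rewrite [X in _ + X]big1 ?addr0// => k _.
by rewrite exprD X0 mul0r scaler0.
Qed.

Lemma qseries_unit (X : tens U U) n1 n2 :
  rep2 s n1 n2 X ^+ n1.+1 = 0 -> qseries s X n1 n2 \in unitmx.
Proof.
move=> X0; rewrite -(@qseries_stable X n1 n2 n1.+2)//.
apply: unitmx_poly_nilpotent X0.
by rewrite /qcoef /qfact big_geq// mulr1 divr1.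
Qed.

Lemma qHH_unit n1 n2 : qHH s n1 n2 \in unitmx.
Proof.
rewrite unitmxE det_diag unitfE; apply/prodf_neq0 => k _.
by rewrite mxE; exact: expfz_neq0.
Qed.

Lemma Rmx_unit n1 n2 : Rmx q s n1 n2 \in unitmx.
Proof.
by rewrite unitmx_mul qHH_unit qseries_unit//; exact: EK_nilpotent.
Qed.

Lemma Rtmx_unit n1 n2 : Rtmx q s n1 n2 \in unitmx.
Proof.
by rewrite unitmx_mul qHH_unit qseries_unit//; exact: FK_nilpotent.
Qed.

Lemma Delta_monoid : monoid_morphism (@Delta K q).
Proof. by apply/ulift_monoid/Delta_rels; rewrite -s2 expf_neq0. Qed.

Lemma Delta_linear : linear (@Delta K q).
Proof. by apply/ulift_linear/Delta_rels; rewrite -s2 expf_neq0. Qed.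

End WellDefined.

Definition flip_mx (K : fieldType) m n (X : 'M[K]_(m * n)) : 'M[K]_(n * m) :=
  let swap k := mxtens_index ((mxtens_unindex k).2, (mxtens_unindex k).1) in
  \matrix_(i, j) X (swap i) (swap j).

Section Flip.
Variables (K : fieldType) (q s : K).
Hypotheses (s0 : s != 0) (s2 : s ^+ 2 = q).

Let swap m n (k : 'I_(n * m)) : 'I_(m * n) :=
  mxtens_index ((mxtens_unindex k).2, (mxtens_unindex k).1).

Let swapK m n : cancel (@swap m n) (@swap n m).
Proof.
by move=> k; rewrite /swap mxtens_indexK -surjective_pairing mxtens_unindexK.
Qed.

Lemma flip_tens m n (A : 'M[K]_m) (B : 'M[K]_n) : flip_mx (A *t B) = B *t A.
Proof. by apply/matrixP => i j; rewrite !mxE !mxtens_indexK mulrC. Qed.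

Lemma flip_mul m n (X Y : 'M[K]_(m * n)) :
  flip_mx (X *m Y) = flip_mx X *m flip_mx Y.
Proof.
apply/matrixP => i j; rewrite !mxE (reindex (@swap m n)) /=; last first.
  by exists (@swap n m) => k _; rewrite swapK.
by apply: eq_bigr => k _; rewrite !mxE.
Qed.

Lemma flip_qHH n1 n2 : flip_mx (qHH s n2 n1) = qHH s n1 n2.
Proof.
apply/matrixP => i j; rewrite !mxE -/(swap _) (can_eq (@swapK _ _)).
by rewrite /swap mxtens_indexK/= mulrC.
Qed.

Lemma Rtmx_flip n1 n2 : Rtmx q s n1 n2 = flip_mx (Rmx q s n2 n1).
Proof.
rewrite /Rmx flip_mul flip_qHH /Rtmx.
pose N := (n1 + n2).+2.
rewrite -(@qseries_stable _ _ _ _ _ _ N); [|by lia|exact: FK_nilpotent].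
rewrite -(@qseries_stable _ _ _ _ _ _ N); [|by lia|exact: EK_nilpotent].
set X := rep2 _ _ _ _; set Y := rep2 _ _ _ _.
have flipY k : flip_mx (Y ^+ k) = flip_mx Y ^+ k.
  by rewrite /Y rep2E// !expmx_tens flip_tens flip_tens expmx_tens.
have -> : flip_mx (\sum_(k < N) qcoef q k *: Y ^+ k) =
    \sum_(k < N) qcoef q k *: flip_mx Y ^+ k.
  apply/matrixP => i j; rewrite mxE !summxE; apply: eq_bigr => k _.
  by rewrite -flipY !mxE.
have XY : X *m qHH s n1 n2 = qHH s n1 n2 *m flip_mx Y.
  have [rE1 rF1 rK1 rKi1] := rho_gens s0 s2 n1.
  have [rE2 rF2 rK2 rKi2] := rho_gens s0 s2 n2.
  have [_ rM1] := rho_monoid s0 s2 n1; have [_ rM2] := rho_monoid s0 s2 n2.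
  rewrite /X /Y !rep2E// flip_tens !rM1 !rM2.
  rewrite rF1 rK1 rKi1 rE2 rK2 rKi2 -!mulmxE.
  rewrite !mul_mx_diag !mul_diag_mx; apply/matrixP => i j.
  case: (mxtens_indexP i) => i1 i2; case: (mxtens_indexP j) => j1 j2.
  rewrite !mxE !mxtens_indexK /=.
  case: eqP => [e1|_]; last by rewrite !(mul0r, mulr0).
  case: eqP => [e2|_]; last by rewrite !(mul0r, mulr0).
  set a := qint q i1; set b := qint q (n2 - i2).
  transitivity (a * b * s ^ (wt n1 j1 - wt n2 i2 + wt n1 j1 * wt n2 j2)).
    by rewrite !expfzDr//; ring.
  transitivity (a * b * s ^ (wt n1 i1 * wt n2 i2 - wt n1 i1 + wt n2 j2)).
    congr (_ * s ^ _).
    have -> : wt n1 i1 = wt n1 j1 - 2 by rewrite /wt e1; lia.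
    have -> : wt n2 i2 = wt n2 j2 + 2 by rewrite /wt -e2; lia.
    ring.
  by rewrite !expfzDr//; ring.
have XYk k : X ^+ k *m qHH s n1 n2 = qHH s n1 n2 *m flip_mx Y ^+ k.
  elim: k => [|k IH]; first by rewrite !expr0 mul1mx mulmx1.
  rewrite exprSr exprS -[X ^+ k * X]/(_ *m _) -mulmxA XY mulmxA IH.
  by rewrite -mulmxA; congr (_ *m _); rewrite -[LHS]exprSr -[RHS]exprS.
rewrite mulmx_suml mulmx_sumr; apply: eq_bigr => k _.
by rewrite -scalemxAl -scalemxAr XYk.
Qed.

End Flip.

(* Main.v *)
Require Import Defs.
From HB Require Import structures.
From mathcomp Require Import all_boot all_order all_algebra.
From mathcomp Require Import reals.
From mathcomp Require boolp.
From mathcomp.real_closed Require Import complex mxtens.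
From mathcomp Require Import ring zify.

Set Implicit Arguments.
Unset Strict Implicit.
Unset Printing Implicit Defensive.

Import GRing.Theory.
Local Open Scope ring_scope.

(** Write R = Q S(y), where Q = q^{2 (H (x) H)} and S(y) is a q-exponential in
    y ~ E q^H (x) q^{-H} F. The first factors of Delta(C) lie in the algebra
    generated by C, q^{2H}, q^H E and F q^H, and conjugation by R maps each of
    these x (x) 1 to a polynomial in the generators: S(q^-2 y) = (1 - y / q) S(y)
    (for y suitably normalized) handles q^{2H}, q^H E commutes with y, and F q^H
    follows from the commutators [y^n, F q^{-H}]. So R_12 C_13 R_12^-1 is an
    explicit element X of U^{(x) 3}, and it commutes with the iterated coproducts
    of the generators by a computation in the PBW basis. The three other
    conjugates come from anti-automorphisms: exchanging q^H and q^{-H} and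
    reversing the order of the tensor factors maps R_12 to R~_23 and fixes C_13
    and X, while exchanging E and F maps R to R~ and fixes C_13. *)

(** * Maps given with a bare proof of linearity *)

Section LinearMap.
Variables (K : fieldType) (V W : lmodType K) (f : V -> W).
Hypothesis fL : linear f.

Lemma linear_map0 : f 0 = 0.
Proof. by have := fL (- 1) 0 0; rewrite !scaleN1r !addNr. Qed.

Lemma linear_mapD x y : f (x + y) = f x + f y.
Proof. by have := fL 1 x y; rewrite !scale1r. Qed.

Lemma linear_mapZ c x : f (c *: x) = c *: f x.
Proof. by have := fL c x 0; rewrite linear_map0 !addr0. Qed.

End LinearMap.

(** * Normal forms in three commuting copies of U_q(sl_2) *)

Inductive gen := GE | GF | GK | GL.

(* E and F are both multiplied by q - q^-1, which makes all structure constants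
   Laurent polynomials in q; GK and GL stand for q^H and q^{-H}. *)
Definition usl2_gens (K : fieldType) (q : K) (A : algType K) (g : gen -> A) :=
  [/\ g GK * g GL = 1, g GL * g GK = 1, g GK * g GE = q *: (g GE * g GK),
      g GK * g GF = q^-1 *: (g GF * g GK)
    & g GE * g GF - g GF * g GE = (q - q^-1) *: (g GK ^+ 2 - g GL ^+ 2)].

Definition commuting (A : pzRingType) (g h : gen -> A) :=
  forall a b, g a * h b = h b * g a.

(* The monomial f^a k^b e^c. *)
Definition pbw1 := (nat * int * nat)%type.
(* (b, n, m) encodes (-1)^b q^n m. *)
Definition pterm (T : Type) := (bool * int * T)%type.

Section Pbw1.
Variables (K : fieldType) (q : K) (A : algType K) (g : gen -> A).

Definition kpow (b : int) : A :=
  match b with Posz n => g GK ^+ n | Negz n => g GL ^+ n.+1 end.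

Definition pbw1_val (m : pbw1) : A :=
  g GF ^+ m.1.1 * kpow m.1.2 * g GE ^+ m.2.

Definition term_val T (v : T -> A) (t : pterm T) : A :=
  (-1) ^+ t.1.1 *: (q ^ t.1.2 *: v t.2).

Definition terms_val T (v : T -> A) (s : seq (pterm T)) : A :=
  \sum_(t <- s) term_val v t.

Definition term_scale T (b : bool) (n : int) (t : pterm T) : pterm T :=
  (b (+) t.1.1, n + t.1.2, t.2).

(** The expansion of e f^a k^b e^c, peeling off one f at a time by e f = f e + (q - q^-1)(k^2 -
    k^-2). The four extra terms are the last summand once k^2 and k^-2 have crossed the remaining
    f's, which costs q^(-2a') and q^(2a'). *)
Fixpoint pbw1_mulE (a : nat) (b : int) (c : nat) : seq (pterm pbw1) :=
  if a is a'.+1 then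
    [seq (t.1, (t.2.1.1.+1, t.2.1.2, t.2.2)) | t <- pbw1_mulE a' b c] ++
    [:: (false, 1 - (2 * a')%:Z, (a', b + 2, c));
        (true, - 1 - (2 * a')%:Z, (a', b + 2, c));
        (true, 1 + (2 * a')%:Z, (a', b - 2, c));
        (false, - 1 + (2 * a')%:Z, (a', b - 2, c))]
  else [:: (false, - b, (0%N, b, c.+1))].

Definition pbw1_mul (x : gen) (m : pbw1) : seq (pterm pbw1) :=
  let: (a, b, c) := m in
  match x with
  | GE => pbw1_mulE a b c
  | GF => [:: (false, 0, (a.+1, b, c))]
  | GK => [:: (false, - a%:Z, (a, b + 1, c))]
  | GL => [:: (false, a%:Z, (a, b - 1, c))]
  end.

Lemma terms_val_cat T (v : T -> A) s t :
  terms_val v (s ++ t) = terms_val v s + terms_val v t.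
Proof. exact: big_cat. Qed.

Hypotheses (q0 : q != 0) (gU : usl2_gens q g).

Lemma gens_kl : g GK * g GL = 1. Proof. by case: gU. Qed.
Lemma gens_lk : g GL * g GK = 1. Proof. by case: gU. Qed.

Lemma gens_lf : g GL * g GF = q *: (g GF * g GL).
Proof.
rewrite -[g GF in LHS]mulr1 -gens_kl [g GF * _]mulrA.
rewrite -[g GF * g GK](scalerK (invr_neq0 q0)) invrK.
case: gU => _ lk _ <- _; rewrite -scalerAl -scalerAr !mulrA lk mul1r.
by [].
Qed.

Lemma gens_el : g GE * g GL = q *: (g GL * g GE).
Proof.
case: gU => kl lk ke _ _.
by rewrite -[LHS]mul1r -lk -mulrA [g GK * _]mulrA ke -scalerAl -mulrA kl mulr1 -scalerAr.
Qed.

Lemma gens_ek : g GE * g GK = q^-1 *: (g GK * g GE).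
Proof. by case: gU => _ _ -> _ _; rewrite scalerA mulVf// scale1r. Qed.

Lemma qcommuteX (x y : A) c n : x * y = c *: (y * x) ->
  x * y ^+ n = c ^+ n *: (y ^+ n * x).
Proof.
move=> xy; elim: n => [|n IH]; first by rewrite !expr0 scale1r mulr1 mul1r.
by rewrite !exprS mulrA xy -!scalerAl -[y * x * _]mulrA IH -scalerAr scalerA mulrA.
Qed.

Lemma kpowS b : g GK * kpow b = kpow (b + 1).
Proof.
case: b => [n|[|n]].
- have -> : Posz n + 1 = Posz n.+1 by lia.
  by rewrite /kpow -exprS.
- by rewrite /kpow expr1 gens_kl.
- have -> : Negz n.+1 + 1 = Negz n by lia.
  by rewrite /kpow exprS mulrA gens_kl mul1r.
Qed.

Lemma kpowP b : g GL * kpow b = kpow (b - 1).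
Proof.
case: b => [[|n]|n].
- by rewrite /kpow mulr1.
- have -> : Posz n.+1 - 1 = Posz n by lia.
  by rewrite /kpow exprS mulrA gens_lk mul1r.
- have -> : Negz n - 1 = Negz n.+1 by lia.
  by rewrite /kpow -exprS.
Qed.

Lemma gens_e_kpow b : g GE * kpow b = q ^ (- b) *: (kpow b * g GE).
Proof.
case: b => n; rewrite /kpow.
  by rewrite (qcommuteX n gens_ek) -invr_expz exprVn.
by rewrite (qcommuteX n.+1 gens_el).
Qed.

Lemma pbw1_valK (m : pbw1) : g GK * pbw1_val m =
  q ^ (- m.1.1%:Z) *: pbw1_val (m.1.1, m.1.2 + 1, m.2).
Proof.
rewrite /pbw1_val /= !mulrA; case: (gU) => _ _ _ kf _.
rewrite (qcommuteX _ kf) -!scalerAl -[_ * g GK * _]mulrA kpowS.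
by rewrite -invr_expz exprVn.
Qed.

Lemma pbw1_valL (m : pbw1) : g GL * pbw1_val m =
  q ^ m.1.1 *: pbw1_val (m.1.1, m.1.2 - 1, m.2).
Proof.
by rewrite /pbw1_val /= !mulrA (qcommuteX _ gens_lf) -!scalerAl -[_ * g GL * _]mulrA kpowP.
Qed.

Lemma pbw1_valF (a : nat) b c : g GF * pbw1_val (a, b, c) = pbw1_val (a.+1, b, c).
Proof. by rewrite /pbw1_val /= !mulrA -exprS. Qed.

Lemma pbw1_mulP x m : terms_val pbw1_val (pbw1_mul x m) = g x * pbw1_val m.
Proof.
case: m => [[a b] c]; case: x; rewrite /pbw1_mul; last 3 first.
- by rewrite /terms_val big_seq1 /term_val /= expr0z !scale1r pbw1_valF.
- by rewrite /terms_val big_seq1 /term_val /= !scale1r pbw1_valK.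
- by rewrite /terms_val big_seq1 /term_val /= !scale1r pbw1_valL.
elim: a => [|a IH]; cbn [pbw1_mulE].
  rewrite /terms_val big_seq1 /term_val /= !scale1r /pbw1_val /= !mul1r.
  by rewrite mulrA gens_e_kpow -scalerAl exprS mulrA.
rewrite terms_val_cat -pbw1_valF mulrA.
have -> : g GE * g GF = g GF * g GE + (q - q^-1) *: (g GK ^+ 2 - g GL ^+ 2).
  by case: gU => _ _ _ _ <-; rewrite addrC subrK.
rewrite mulrDl -mulrA -IH; congr (_ + _).
  rewrite /terms_val mulr_sumr big_map; apply: eq_bigr => -[[? ?] [[? ?] ?]] _.
  by rewrite /term_val /= -pbw1_valF !scalerAr.
rewrite -scalerAl mulrBl !expr2 -!mulrA !(pbw1_valK, pbw1_valL) /= -!scalerAr.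
rewrite !(pbw1_valK, pbw1_valL) /= /terms_val !big_cons big_nil /term_val /=.
rewrite !expr0 !expr1 !scaleN1r !scale1r -!addrA addr0.
set x := pbw1_val (a, b + 2, c); set y := pbw1_val (a, b - 2, c).
transitivity ((q ^ (1 - (2 * a)%:Z) - q ^ (- 1 - (2 * a)%:Z)) *: x
  - (q ^ (1 + (2 * a)%:Z) - q ^ (- 1 + (2 * a)%:Z)) *: y).
  by rewrite !scalerBl opprB -!addrA [_ *: y - _ *: y]addrC.
rewrite scalerBr !scalerA.
have -> : (2 * a)%:Z = a%:Z + a%:Z by rewrite mul2n -addnn PoszD.
rewrite !expfzDr// opprD !expfzDr// expr1z exprN1.
by congr (_ *: _ - _ *: _); ring.
Qed.

End Pbw1.

Definition pbw3 := (pbw1 * pbw1 * pbw1)%type.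

(** Syntax for proof by reflection: scalars in Z[q, q^-1] and, next, polynomials in three sets of
    generators, [UGen i x] being the generator [x] of slot [i], counted from 0. *)
Inductive sexpr := SQ | SQi | SOne | SAdd of sexpr & sexpr
  | SOpp of sexpr | SMul of sexpr & sexpr.

Inductive uexpr := UGen of nat & gen | UOne | UZero | UNeg of uexpr
  | USum of uexpr & uexpr | UProd of uexpr & uexpr | UScale of sexpr & uexpr.

Arguments pbw1_val : simpl never.

Section Pbw3.
Variables (K : fieldType) (q : K) (A : algType K) (g1 g2 g3 : gen -> A).

Definition pbw3_val (m : pbw3) : A :=
  pbw1_val g1 m.1.1 * pbw1_val g2 m.1.2 * pbw1_val g3 m.2.

Definition slot_gens (i : nat) : gen -> A :=
  match i with 0%N => g1 | 1%N => g2 | _ => g3 end.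

Fixpoint sexpr_val (c : sexpr) : K :=
  match c with
  | SQ => q | SQi => q^-1 | SOne => 1
  | SAdd c d => sexpr_val c + sexpr_val d | SOpp c => - sexpr_val c | SMul c d => sexpr_val c * sexpr_val d
  end.

Fixpoint uval (x : uexpr) : A :=
  match x with
  | UGen i x => slot_gens i x
  | UOne => 1 | UZero => 0 | UNeg x => - uval x
  | USum x y => uval x + uval y | UProd x y => uval x * uval y
  | UScale c x => sexpr_val c *: uval x
  end.

Definition pbw3_mul (i : nat) (x : gen) (m : pbw3) : seq (pterm pbw3) :=
  let: (m1, m2, m3) := m in
  match i with
  | 0%N => [seq (t.1, (t.2, m2, m3)) | t <- pbw1_mul x m1]
  | 1%N => [seq (t.1, (m1, t.2, m3)) | t <- pbw1_mul x m2]
  | _ => [seq (t.1, (m1, m2, t.2)) | t <- pbw1_mul x m3]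
  end.

Fixpoint sact (c : sexpr) (s : seq (pterm pbw3)) : seq (pterm pbw3) :=
  match c with
  | SQ => [seq term_scale false 1 t | t <- s]
  | SQi => [seq term_scale false (- 1) t | t <- s]
  | SOne => s
  | SAdd c d => sact c s ++ sact d s
  | SOpp c => [seq term_scale true 0 t | t <- sact c s]
  | SMul c d => sact c (sact d s)
  end.

(** An expression acts by left multiplication on sums of PBW monomials, so only products of a
    generator and a monomial ever have to be straightened; the normal form is the action on 1. *)
Fixpoint uact (x : uexpr) (s : seq (pterm pbw3)) : seq (pterm pbw3) :=
  match x with
  | UGen i x => flatten [seq [seq term_scale t.1.1 t.1.2 u | u <- pbw3_mul i x t.2] | t <- s]
  | UOne => s
  | UZero => [::]
  | UNeg x => [seq term_scale true 0 t | t <- uact x s]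
  | USum x y => uact x s ++ uact y s
  | UProd x y => uact x (uact y s)
  | UScale c x => sact c (uact x s)
  end.

Definition pbw3_one : seq (pterm pbw3) :=
  [:: (false, 0, ((0%N, 0, 0%N), (0%N, 0, 0%N), (0%N, 0, 0%N)))].

Definition unorm (x : uexpr) := uact x pbw3_one.

(** Coefficients are never collected: each term is a signed power of q times a monomial, and the sum
    vanishes as soon as positive and negative terms match as multisets. *)
Definition uzerob (s : seq (pterm pbw3)) :=
  perm_eq [seq (t.1.2, t.2) | t <- s & t.1.1] [seq (t.1.2, t.2) | t <- s & ~~ t.1.1].

Hypotheses (q0 : q != 0).
Hypotheses (g1U : usl2_gens q g1) (g2U : usl2_gens q g2) (g3U : usl2_gens q g3).
Hypotheses (g12 : commuting g1 g2) (g13 : commuting g1 g3) (g23 : commuting g2 g3).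

Local Notation tval := (terms_val q pbw3_val).

Lemma terms_val_scale b n s :
  tval [seq term_scale b n t | t <- s] = (-1) ^+ b *: (q ^ n *: tval s).
Proof.
rewrite /terms_val big_map !scaler_sumr; apply: eq_bigr => -[[c m] x] _.
rewrite /term_val /= signr_addb expfzDr// !scalerA; congr (_ *: _); ring.
Qed.

Lemma pbw1_comm (g h : gen -> A) a m : commuting h g ->
  g a * pbw1_val h m = pbw1_val h m * g a.
Proof.
move=> gh; have gX b n : g a * h b ^+ n = h b ^+ n * g a.
  by apply: commrX; rewrite /GRing.comm gh.
rewrite /pbw1_val mulrA mulrA gX -[_ * g a * _]mulrA.
have -> : g a * kpow h m.1.2 = kpow h m.1.2 * g a.
  by case: m.1.2 => n; exact: gX.
by rewrite -!mulrA gX.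
Qed.

Lemma pbw3_mulP i x m : tval (pbw3_mul i x m) = slot_gens i x * pbw3_val m.
Proof.
have AA (a b c d : A) : a * (b * c * d) = a * b * c * d by rewrite !mulrA.
case: m => [[m1 m2] m3]; case: i => [|[|i]] /=;
  rewrite /terms_val big_map /pbw3_val /= AA.
- rewrite -(pbw1_mulP q0 g1U) /terms_val !mulr_suml; apply: eq_bigr => t _.
  by rewrite /term_val /= -!scalerAl.
- rewrite (pbw1_comm _ _ g12) -[_ * g2 x * _]mulrA -(pbw1_mulP q0 g2U).
  rewrite /terms_val mulr_sumr mulr_suml; apply: eq_bigr => t _.
  by rewrite /term_val /= -!scalerAr -!scalerAl.
- rewrite (pbw1_comm _ _ g13) -[_ * g3 x * _]mulrA (pbw1_comm _ _ g23).
  rewrite [_ * (_ * g3 x)]mulrA -[_ * g3 x * _]mulrA -(pbw1_mulP q0 g3U).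
  rewrite /terms_val mulr_sumr; apply: eq_bigr => t _.
  by rewrite /term_val /= -!scalerAr.
Qed.

Lemma sactP c s : tval (sact c s) = sexpr_val c *: tval s.
Proof.
elim: c s => [|||c IHc d IHd|c IHc|c IHc d IHd] s /=.
- by rewrite terms_val_scale expr0 scale1r expr1z.
- by rewrite terms_val_scale expr0 scale1r exprN1.
- by rewrite scale1r.
- by rewrite terms_val_cat IHc IHd scalerDl.
- by rewrite terms_val_scale expr1 expr0z scale1r scaleN1r scaleNr IHc.
- by rewrite IHc IHd scalerA.
Qed.

Lemma uactP x s : tval (uact x s) = uval x * tval s.
Proof.
elim: x s => [i x|||x IHx|x IHx y IHy|x IHx y IHy|c x IHx] s /=.
- elim: s => [|t s IH]; first by rewrite /terms_val !big_nil mulr0.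
  rewrite /= terms_val_cat IH terms_val_scale pbw3_mulP.
  rewrite [in RHS]/terms_val big_cons mulrDr /term_val.
  by rewrite -!scalerAr.
- by rewrite mul1r.
- by rewrite mul0r /terms_val big_nil.
- by rewrite terms_val_scale expr1 expr0z scale1r scaleN1r mulNr IHx.
- by rewrite terms_val_cat IHx IHy mulrDl.
- by rewrite IHx IHy mulrA.
- by rewrite sactP IHx scalerAl.
Qed.

Lemma uzerobP s : uzerob s -> tval s = 0.
Proof.
move=> /(perm_map (fun t : int * pbw3 => q ^ t.1 *: pbw3_val t.2)) st.
have := perm_big (op := +%R) (x := 0) _ st (P := xpredT) (F := id).
rewrite !big_map !big_filter /= => eq_s.
rewrite /terms_val (bigID (fun t => t.1.1)) /=.
under eq_bigr => t tn do rewrite /term_val tn expr1 scaleN1r.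
under [X in _ + X]eq_bigr => t /negbTE tn do rewrite /term_val tn expr0 scale1r.
by rewrite sumrN eq_s addNr.
Qed.

(** The difference acts on 1 and the resulting terms cancel in pairs; an identity in the algebra is
    thus reduced to a computation on lists. *)
Lemma uval_eq x y : uzerob (unorm (USum x (UNeg y))) -> uval x = uval y.
Proof.
move=> /uzerobP; rewrite /unorm uactP.
have -> : tval pbw3_one = 1.
  rewrite /pbw3_one /terms_val big_seq1 /term_val /= expr0 expr0z !scale1r.
  by rewrite /pbw3_val /pbw1_val /= !expr0 !mulr1.
by rewrite mulr1 => /= /eqP; rewrite subr_eq0 => /eqP.
Qed.

End Pbw3.

(** * The opposite algebra *)

Section Converse.
Variables (K : fieldType) (A : algType K).

Let scalerAl_converse (c : K) (x y : A^c) : c *: (x * y) = (c *: x : A^c) * y.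
Proof. exact: (@scalerAr K A c y x). Qed.
Let scalerAr_converse (c : K) (x y : A^c) : c *: (x * y) = x * (c *: y : A^c).
Proof. exact: (@scalerAl K A c y x). Qed.

HB.instance Definition _ := GRing.Lmodule.on A^c.
HB.instance Definition _ := GRing.Lmodule_isLalgebra.Build K A^c scalerAl_converse.
HB.instance Definition _ := GRing.Lalgebra_isAlgebra.Build K A^c scalerAr_converse.

End Converse.

(** * Explicit elements in three slots and their identities *)

Section Elements.
Variables (K : fieldType) (q : K) (A : algType K).
Implicit Types g h : gen -> A.

Definition coprod g h (x : gen) : A :=
  match x with
  | GE => g GE * h GL + g GK * h GE
  | GF => g GF * h GL + g GK * h GF
  | GK => g GK * h GK
  | GL => g GL * h GL
  end.

(** With E and F rescaled by q - q^-1 this is -(q + q^-1) times the Casimir element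
    ([casimir_ugen]). *)
Definition cas g : A :=
  g GF * g GE + (q *: g GK ^+ 2 + q^-1 *: g GL ^+ 2).

(* The images of q^{2H}, q^H E and F q^H, in the first factor, under conjugation
   by R. *)
Definition twistK g h : A := g GK ^+ 2 - g GK * g GE * (h GK * h GF).
Definition twistE g h : A := g GK * g GE * h GK ^+ 2.
Definition twistF g h : A :=
  coprod g h GF * coprod g h GL * twistK g h - g GL ^+ 2 * (h GF * h GL).

(** The sum of [cas_coprod13] with q^{2H}, F q^H and q^H E in the first slot replaced by their
    conjugates; [cas g1] is kept because it commutes with R. *)
Definition cas13_twist g1 g2 g3 : A :=
  cas g1 * g3 GL ^+ 2 + twistK g1 g2 * (cas g3 - (q + q^-1) *: g3 GL ^+ 2)
  + twistF g1 g2 * (g3 GL * g3 GE) + twistE g1 g2 * (g3 GF * g3 GL).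

End Elements.

(** Both exchanges send generators of U to generators for the opposite product, hence describe
    anti-automorphisms ([exchKL_gens], [exchEF_gens]). *)
Definition exchKL (A : Type) (g : gen -> A) (x : gen) : A :=
  match x with GE => g GE | GF => g GF | GK => g GL | GL => g GK end.
Definition exchEF (A : Type) (g : gen -> A) (x : gen) : A :=
  match x with GE => g GF | GF => g GE | GK => g GK | GL => g GL end.

Ltac reify_scalar q c :=
  match c with
  | q => constr:(SQ)
  | q^-1 => constr:(SQi)
  | 1 => constr:(SOne)
  | ?a + ?b => let x := reify_scalar q a in let y := reify_scalar q b in constr:(SAdd x y)
  | ?a * ?b => let x := reify_scalar q a in let y := reify_scalar q b in constr:(SMul x y)
  | - ?a => let x := reify_scalar q a in constr:(SOpp x)
  | ?a ^+ 2 => let x := reify_scalar q a in constr:(SMul x x)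
  end.

(** A product taken in the opposite algebra is reified with its factors exchanged, so that
    identities mixing both products become identities in [A]. *)
Ltac reify_gens q g1 g2 g3 t :=
  match t with
  | g1 ?x => constr:(UGen 0 x)
  | g2 ?x => constr:(UGen 1 x)
  | g3 ?x => constr:(UGen 2 x)
  | 1 => constr:(UOne)
  | 0 => constr:(UZero)
  | - ?a => let x := reify_gens q g1 g2 g3 a in constr:(UNeg x)
  | ?a + ?b => let x := reify_gens q g1 g2 g3 a in
    let y := reify_gens q g1 g2 g3 b in constr:(USum x y)
  | ?c *: ?a => let x := reify_scalar q c in
    let y := reify_gens q g1 g2 g3 a in constr:(UScale x y)
  | ?a ^+ 2 => let x := reify_gens q g1 g2 g3 a in constr:(UProd x x)
  | @GRing.mul ?R ?a ?b =>
    let x := reify_gens q g1 g2 g3 a in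
    let y := reify_gens q g1 g2 g3 b in
    match R with
    | context [GRing_converse__canonical__GRing_Algebra] => constr:(UProd y x)
    | _ => constr:(UProd x y)
    end
  end.

Ltac usl2_ring q g1 g2 g3 :=
  cbv beta iota delta [cas13_twist twistK twistE twistF cas coprod exchKL exchEF];
  match goal with |- ?a = ?b =>
    let x := reify_gens q g1 g2 g3 a in
    let y := reify_gens q g1 g2 g3 b in
    refine (@uval_eq _ q _ g1 g2 g3 _ _ _ _ _ _ _ x y _) => //; vm_compute; reflexivity
  end.

Section Identities.
Variables (K : fieldType) (q : K) (A : algType K) (g1 g2 g3 : gen -> A).
Hypotheses (q0 : q != 0).
Hypotheses (g1U : usl2_gens q g1) (g2U : usl2_gens q g2) (g3U : usl2_gens q g3).
Hypotheses (g12 : commuting g1 g2) (g13 : commuting g1 g3) (g23 : commuting g2 g3).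

(** The grouping isolates in the first slot the four elements whose conjugates by R are computed
    separately: the Casimir element, q^{2H}, F q^H and q^H E. *)
Lemma cas_coprod13 : cas q (coprod g1 g3) =
  cas q g1 * g3 GL ^+ 2 + g1 GK ^+ 2 * (cas q g3 - (q + q^-1) *: g3 GL ^+ 2)
  + g1 GF * g1 GK * (g3 GL * g3 GE) + g1 GK * g1 GE * (g3 GF * g3 GL).
Proof. usl2_ring q g1 g2 g3. Qed.

(** Both sides are polynomials in the generators, so PBW normal forms decide the commutation without
    any R-matrix. *)
Lemma cas13_twist_comm x :
  GRing.comm (coprod (coprod g1 g2) g3 x) (cas13_twist q g1 g2 g3).
Proof. rewrite /GRing.comm; case: x; usl2_ring q g1 g2 g3. Qed.

(** This invariance makes the two conjugates agree: the same element serves for R_12 and, through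
    the anti-automorphism, for the flip of R in slots 2 and 3. *)
Lemma cas13_twist_rev :
  @cas13_twist K q (A^c : algType K) (exchKL g3) (exchKL g2) (exchKL g1) = cas13_twist q g1 g2 g3.
Proof. usl2_ring q g1 g2 g3. Qed.

End Identities.

(** * Conjugation by the R-matrix *)

Section QExponential.
Variables (K : fieldType) (q : K) (A : algType K) (b : nat -> K) (N : nat) (y : A).
Hypotheses (q0 : q != 0) (yN : y ^+ N = 0).
Hypothesis bS : forall n, (n < N)%N ->
  b n.+1 * (q ^+ n.+1 - q ^- n.+1) = q ^+ n * b n.

(** The recurrence [bS] makes this a q-exponential; truncating at [N] loses nothing because y^N =
    0. *)
Definition qexp : A := \sum_(n < N) b n *: y ^+ n.

Lemma qcomm_exp x n : y * x = q ^- 2 *: (x * y) ->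
  x * y ^+ n = q ^+ n ^+ 2 *: (y ^+ n * x).
Proof.
move=> yx; rewrite -exprM mulnC exprM; apply: qcommuteX.
by rewrite yx scalerA divff ?scale1r// expf_neq0.
Qed.

Lemma qexp_comm x : x * y = y * x -> qexp * x = x * qexp.
Proof.
move=> xy; apply/esym/commr_sum => n _.
by rewrite /GRing.comm -scalerAr -scalerAl; congr (_ *: _); exact: commrX.
Qed.

(** Moving x across turns S(y) into S(q^-2 y), and the q-difference equation S(q^-2 y) = (1 - q^-1
    y) S(y) is the recurrence [bS] read coefficient by coefficient. *)
Lemma qexp_qcomm x : y * x = q ^- 2 *: (x * y) ->
  qexp * x = x * (1 - q^-1 *: y) * qexp.
Proof.
move=> yx; rewrite -mulrA.
have -> : qexp * x = x * \sum_(n < N.+1) (b n * q ^+ n ^- 2) *: y ^+ n.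
  rewrite big_ord_recr /= yN scaler0 addr0 mulr_suml mulr_sumr.
  apply: eq_bigr => n _; rewrite -scalerAl -scalerAr (qcomm_exp n yx) scalerA.
  by rewrite mulfVK// !expf_neq0.
congr (_ * _); apply/eqP; rewrite -subr_eq0 mulrBl mul1r opprB addrCA addrC.
(* The term of index N is zero; adding it lets the sum shed its constant term and still match the N
   terms of q^-1 y S(y). *)
rewrite [X in _ - X](_ : qexp = \sum_(n < N.+1) b n *: y ^+ n); last first.
  by rewrite big_ord_recr /= yN scaler0 addr0.
rewrite -sumrB big_ord_recl /= !expr0 expr1n invr1 mulr1 subrr add0r.
rewrite -scalerAl mulr_sumr scaler_sumr.
rewrite -big_split /= big1// => n _.
rewrite /bump /= add1n -scalerBl -scalerAr -exprS scalerA -scalerDl.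
apply/eqP; rewrite scaler_eq0; apply/orP; left; apply/eqP.
have -> : q^-1 * b n = q ^- n.+1 * (q ^+ n * b n).
  by rewrite exprS; field; rewrite q0 expf_neq0.
rewrite -bS//; have : q ^+ n.+1 != 0 by rewrite expf_neq0.
by move: (q ^+ n.+1) => c c0; field.
Qed.

(* With [n] = (q^n - q^-n) / (q - q^-1), the commutator of y^(n+1) with g is
   (q - q^-1) [n+1] w (q^-n u - q^n v) y^n; the recurrence for b turns the sum
   of these terms back into q-exponentials. *)
Lemma qexp_commutator g w u v x :
    y * w = w * y -> y * u = q ^- 2 *: (u * y) -> y * v = q ^+ 2 *: (v * y) ->
    y * g = g * y + (q - q^-1) *: (w * (u - v)) ->
    y * x = q ^- 2 *: (x * y) ->
  qexp * g * x = (g + w * u) * qexp * x - w * v * x * qexp.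
Proof.
move=> yw yu yv yg yx.
pose d n := q ^+ n.+1 - q ^- n.+1.
have yt c c' : y * (w * (c *: u - c' *: v)) =
    w * ((c * q ^- 2) *: u - (c' * q ^+ 2) *: v) * y.
  by rewrite mulrA yw -mulrA mulrBr -!scalerAr yu yv !scalerA -mulrA mulrBl -!scalerAl.
have yXg n : y ^+ n.+1 * g =
    g * y ^+ n.+1 + d n *: (w * (q ^- n *: u - q ^+ n *: v) * y ^+ n).
  elim: n => [|n IH].
    by rewrite !expr1 yg !expr0 invr1 !scale1r mulr1.
  rewrite [y ^+ n.+2]exprS -mulrA IH mulrDr mulrA yg mulrDl -[g * y * _]mulrA -exprS -addrA.
  congr (_ + _).
  rewrite -scalerAr mulrA yt -[_ * y * _]mulrA -exprS !scalerAl -mulrDl; congr (_ * _).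
  rewrite -!scalerAl !scalerAr -mulrDr; congr (_ * _).
  rewrite !scalerBr !scalerA addrACA -opprD -!scalerDl /d.
  have : q ^+ n != 0 by rewrite expf_neq0.
  by rewrite !exprS; move: (q ^+ n) => c c0; congr (_ *: _ - _ *: _); field;
    rewrite ?q0 ?c0.
(* By [bS] the factor d n turns b_{n+1} into q^n b_n, which leaves b_n for u and b_n q^(2n) for v;
   this q^(2n) disappears when y^n crosses x at the end. *)
have -> : qexp * g = g * qexp + w * (u * qexp - v * \sum_(n < N) (b n * q ^+ n ^+ 2) *: y ^+ n).
  transitivity (\sum_(n < N.+1) b n *: (y ^+ n * g)).
    rewrite big_ord_recr /= yN mul0r scaler0 addr0 mulr_suml.
    by apply: eq_bigr => n _; rewrite -scalerAl.
  have -> : g * qexp = \sum_(n < N.+1) b n *: (g * y ^+ n).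
    rewrite big_ord_recr /= yN mulr0 scaler0 addr0 mulr_sumr.
    by apply: eq_bigr => n _; rewrite -scalerAr.
  rewrite !big_ord_recl /= !expr0 mul1r mulr1 -addrA; congr (_ + _).
  rewrite !mulr_sumr -sumrB mulr_sumr -big_split; apply: eq_bigr => n _ /=.
  rewrite /bump /= add1n yXg scalerDr scalerA bS//; congr (_ + _).
  rewrite -[w * _ * _]mulrA scalerAr; congr (_ * _).
  rewrite mulrBl -!scalerAl -!scalerAr scalerBr !scalerA.
  have : q ^+ n != 0 by rewrite expf_neq0.
  move: (q ^+ n) => c c0; congr (_ *: _ - _ *: _); last by ring.
  by rewrite mulrAC divff// mul1r.
rewrite mulrDl [(g + _) * _]mulrDl mulrDl -addrA; congr (_ + _).
rewrite mulrBr mulrBl -!mulrA; congr (_ - _ * (_ * _)).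
rewrite mulr_suml mulr_sumr; apply: eq_bigr => n _.
by rewrite -scalerAl -scalerAr (qcomm_exp n yx) scalerA.
Qed.

End QExponential.

Section Rmatrix.
Variables (K : fieldType) (q : K) (A : algType K).
Implicit Types (g h : gen -> A) (Q : A).

Definition cartan_shift h (x : gen) : A :=
  match x with GE => h GK ^+ 2 | GF => h GL ^+ 2 | _ => 1 end.

(* The commutation rules of Q = q^{2 (H (x) H)}. *)
Definition cartan_conj Q g h :=
  forall x, Q * g x = g x * cartan_shift h x * Q.

Definition Rterm g h : A := g GE * g GK * (h GL * h GF).

Variables (b : nat -> K) (N : nat) (Q : A) (g1 g2 g3 : gen -> A).
Hypotheses (q0 : q != 0).
Hypotheses (g1U : usl2_gens q g1) (g2U : usl2_gens q g2) (g3U : usl2_gens q g3).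
Hypotheses (g12 : commuting g1 g2) (g13 : commuting g1 g3) (g23 : commuting g2 g3).
Hypothesis bS : forall n, (n < N)%N ->
  b n.+1 * (q ^+ n.+1 - q ^- n.+1) = q ^+ n * b n.
Hypothesis yN : Rterm g1 g2 ^+ N = 0.
Hypotheses (Q12 : cartan_conj Q g1 g2) (Q21 : cartan_conj Q g2 g1).

Local Notation y := (Rterm g1 g2).
Local Notation S := (qexp b N y).

Let push (x x' : A) : Q * x = x' * Q -> forall z, Q * (x * z) = x' * (Q * z).
Proof. by move=> xx' z; rewrite !mulrA xx'. Qed.

Let QE1 := Q12 GE. Let QF1 := Q12 GF.
Let QF2 := Q21 GF.
Let QK1 : Q * g1 GK = g1 GK * Q. Proof. by rewrite Q12 mulr1. Qed.
Let QL1 : Q * g1 GL = g1 GL * Q. Proof. by rewrite Q12 mulr1. Qed.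
Let QL2 : Q * g2 GL = g2 GL * Q. Proof. by rewrite Q21 mulr1. Qed.

Lemma twistK_R : twistK g1 g2 * (Q * S) = Q * S * g1 GK ^+ 2.
Proof.
rewrite -[Q * S * _]mulrA (qexp_qcomm q0 yN bS); last first.
  by rewrite /Rterm -exprVn; usl2_ring q g1 g2 g3.
rewrite [LHS]mulrA [RHS]mulrA; congr (_ * _).
(* This is q^{2H}(1 - q^-1 y) after Q has crossed it generator by generator: E in slot 1 picks up
   q^{2H} in slot 2, and F in slot 2 picks up q^{-2H} in slot 1. *)
have -> : twistK g1 g2 = g1 GK ^+ 2 * (1 - q^-1 *:
    (g1 GE * g2 GK ^+ 2 * g1 GK * (g2 GL * (g2 GF * g1 GL ^+ 2)))).
  by usl2_ring q g1 g2 g3.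
rewrite expr2 -!mulrA !(push QK1) mulrBr mulr1 -scalerAr /Rterm.
rewrite -!mulrA (push QE1) (push QK1) (push QL2) QF2 /=.
by rewrite mulrBl mul1r -scalerAl !mulrA.
Qed.

(** q^H E is a multiple of E q^H and so commutes with y; only the Cartan factor Q changes it. *)
Lemma twistE_R : twistE g1 g2 * (Q * S) = Q * S * (g1 GK * g1 GE).
Proof.
rewrite -[RHS]mulrA (qexp_comm b N); last first.
  by rewrite /Rterm; usl2_ring q g1 g2 g3.
by rewrite -!mulrA (push QK1) (push QE1) /twistE !mulrA.
Qed.

Lemma twistF_R : twistF g1 g2 * (Q * S) = Q * S * (g1 GF * g1 GK).
Proof.
(* The splitting F q^H = (F q^{-H}) q^{2H} fits [qexp_commutator]: in slot 1, g = F q^{-H}, u = x =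
   q^{2H} and v = q^{-2H}; in slot 2, w = q^-1 q^{-H} F. In the last term v x = 1. *)
have -> : g1 GF * g1 GK = g1 GF * g1 GL * g1 GK ^+ 2 by usl2_ring q g1 g2 g3.
rewrite -[RHS]mulrA [S * (_ * _)]mulrA.
rewrite (@qexp_commutator _ q _ b N y q0 yN bS _ (q^-1 *: (g2 GL * g2 GF))
  (g1 GK ^+ 2) (g1 GL ^+ 2)); do 1?[by rewrite /Rterm -?exprVn; usl2_ring q g1 g2 g3].
have -> : q^-1 *: (g2 GL * g2 GF) * g1 GL ^+ 2 * g1 GK ^+ 2 = g2 GF * g2 GL.
  by usl2_ring q g1 g2 g3.
have -> : g1 GF * g1 GL + q^-1 *: (g2 GL * g2 GF) * g1 GK ^+ 2 =
    g1 GF * g1 GL + g2 GF * g2 GL * g1 GK ^+ 2 by usl2_ring q g1 g2 g3.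
have QX : Q * (g1 GF * g1 GL + g2 GF * g2 GL * g1 GK ^+ 2) =
    (g1 GF * g2 GL ^+ 2 * g1 GL + g2 GF * g1 GL ^+ 2 * g2 GL * g1 GK ^+ 2) * Q.
  rewrite mulrDr mulrDl [g1 GK ^+ 2]expr2 -!mulrA (push QF1) (push QF2) (push QL2).
  by rewrite (push QK1) QK1 QL1 /= !mulrA.
have QZ : Q * (g2 GF * g2 GL) = g2 GF * g1 GL ^+ 2 * g2 GL * Q.
  by rewrite (push QF2) QL2 /= !mulrA.
(* The remaining Q S q^{2H} becomes [twistK] times Q S, which is how [twistK] enters [twistF]. *)
rewrite mulrBr -[_ * S * _]mulrA (push QX) (push QZ) [Q * (S * _)]mulrA -twistK_R.
rewrite [X in _ = X - _]mulrA -mulrBl.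
by congr (_ * _); usl2_ring q g1 g2 g3.
Qed.

Hypothesis Q3 : forall x, Q * g3 x = g3 x * Q.

(** Q S commutes with slot 3 and with the Casimir element of slot 1, so the expansion of
    [cas_coprod13] can be conjugated term by term. *)
Lemma cas13_twist_R :
  cas13_twist q g1 g2 g3 * (Q * S) = Q * S * cas q (coprod g1 g3).
Proof.
set R := Q * S.
have R3 x : GRing.comm R (g3 x).
  rewrite /GRing.comm mulrA -Q3 -!mulrA; congr (_ * _); apply: qexp_comm.
  by case: x; rewrite /Rterm; usl2_ring q g1 g2 g3.
have R1 : GRing.comm R (cas q g1).
  have casS : S * cas q g1 = cas q g1 * S.
    by apply: qexp_comm; rewrite /Rterm; usl2_ring q g1 g2 g3.
  rewrite /GRing.comm /R -mulrA casS !mulrA; congr (_ * _).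
  (* Q is only known through its commutation rules, so it is moved by hand: the shifts it produces
     on F and on E are inverse to each other. *)
  rewrite /cas mulrDl !mulrDr !mulrDl !expr2 -!scalerAl -!scalerAr.
  rewrite -!mulrA !(push QK1) !(push QL1) QK1 QL1 (push QF1) QE1 /=.
  by congr (_ + _); rewrite !mulrA; congr (_ * _); usl2_ring q g1 g2 g3.
have commZ c x : GRing.comm R x -> GRing.comm R (c *: x).
  by rewrite /GRing.comm -scalerAr -scalerAl => ->.
have R3c : GRing.comm R (cas q g3 - (q + q^-1) *: g3 GL ^+ 2).
  apply: commrD; first by do ?[apply: commrD | apply: commZ | apply: commrX | apply: commrM].
  by apply/commrN/commZ/commrX.
have TK : twistK g1 g2 * R = R * g1 GK ^+ 2 := twistK_R.
have TE : twistE g1 g2 * R = R * (g1 GK * g1 GE) := twistE_R.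
have TF : twistF g1 g2 * R = R * (g1 GF * g1 GK) := twistF_R.
clearbody R.
rewrite (cas_coprod13 q0 g1U g2U g3U g12 g13 g23) /cas13_twist !(mulrDl _ _ R) !(mulrDr R).
congr (_ + _ + _ + _).
- by rewrite -[LHS]mulrA [RHS]mulrA R1 -[RHS]mulrA -(commrX 2 (R3 GL)).
- by rewrite -[LHS]mulrA -R3c [LHS]mulrA TK -[LHS]mulrA.
- by rewrite -[LHS]mulrA -(commrM (R3 GL) (R3 GE)) [LHS]mulrA TF -[LHS]mulrA.
- by rewrite -[LHS]mulrA -(commrM (R3 GF) (R3 GL)) [LHS]mulrA TE -[LHS]mulrA.
Qed.

End Rmatrix.

(** * Anti-automorphisms and the three remaining conjugations *)

Section Transposes.
Variables (K : fieldType) (q : K) (A : algType K).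
Hypothesis q0 : q != 0.
Implicit Types g h : gen -> A.
Local Notation Ac := (A^c : algType K).

(* With the three factors reversed as well, this anti-automorphism maps R_12 to
   the flip of R in the factors 2 and 3. *)
Lemma exchKL_gens g : usl2_gens q g -> @usl2_gens K q Ac (exchKL g).
Proof.
move=> gU; have [kl lk ke kf ef] := gU; split=> //.
- exact: (gens_el gU).
- have : g GF * g GL = q^-1 *: (g GL * g GF).
    by rewrite (gens_lf q0 gU) scalerA mulVf// scale1r.
  by [].
have : g GF * g GE - g GE * g GF = (q - q^-1) *: (g GL ^+ 2 - g GK ^+ 2).
  by rewrite -opprB ef -scalerN opprB.
by [].
Qed.

Lemma exchEF_gens g : usl2_gens q g -> @usl2_gens K q Ac (exchEF g).
Proof.
move=> gU; have [kl lk ke kf ef] := gU; split=> //.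
- have : g GF * g GK = q *: (g GK * g GF) by rewrite kf scalerA divff// scale1r.
  by [].
- exact: (gens_ek q0 gU).
Qed.

Lemma exchKL_commuting g h : commuting g h -> @commuting Ac (exchKL h) (exchKL g).
Proof. by move=> gh [] []; exact: gh. Qed.

Lemma exchEF_commuting g h : commuting g h -> @commuting Ac (exchEF g) (exchEF h).
Proof. by move=> gh [] []; exact/esym/gh. Qed.

Lemma qexp_converse (b : nat -> K) N (y : A) : @qexp K Ac b N y = qexp b N y.
Proof. by apply: eq_bigr => n _; rewrite revrX. Qed.

(** In the opposite algebra [cartan_conj] asks for the shift on the other side of Q. The shift
    commutes with Q and is inverted when it changes sides, which amounts to exchanging q^H and
    q^{-H} in [h]. *)
Lemma cartan_flip (Q : A) g h x : usl2_gens q h -> commuting g h ->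
  cartan_conj Q h g -> cartan_conj Q g h ->
  g x * Q = Q * (cartan_shift (exchKL h) x * g x).
Proof.
move=> [kl lk _ _ _] gh Qh Qg.
have QK : Q * h GK = h GK * Q by rewrite Qh mulr1.
have QL : Q * h GL = h GL * Q by rewrite Qh mulr1.
case: x => /=; last 2 first.
- by rewrite mul1r Qg mulr1.
- by rewrite mul1r Qg mulr1.
- rewrite expr2 !mulrA QL -[_ * Q * h GL]mulrA QL -!mulrA Qg /= expr2 !mulrA.
  rewrite -[h GL * h GL * _ * _]mulrA gh [_ * (_ * _)]mulrA -[h GL * h GL * _]mulrA lk mulr1.
  by rewrite -[_ * g GE * _]mulrA gh mulrA lk mul1r.
- rewrite expr2 !mulrA QK -[_ * Q * h GK]mulrA QK -!mulrA Qg /= expr2 !mulrA.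
  rewrite -[h GK * h GK * _ * _]mulrA gh [_ * (_ * _)]mulrA -[h GK * h GK * _]mulrA kl mulr1.
  by rewrite -[_ * g GF * _]mulrA gh mulrA kl mul1r.
Qed.

Lemma exchKL_cartan (Q : A) g h : usl2_gens q h -> commuting g h ->
  cartan_conj Q h g -> cartan_conj Q g h ->
  @cartan_conj K Ac Q (exchKL g) (exchKL h).
Proof.
move=> hU gh Qh Qg x.
have := cartan_flip (match x with GK => GL | GL => GK | y => y end) hU gh Qh Qg.
by case: x.
Qed.

Lemma exchEF_cartan (Q : A) g h : usl2_gens q h -> commuting g h ->
  cartan_conj Q h g -> cartan_conj Q g h ->
  @cartan_conj K Ac Q (exchEF g) (exchEF h).
Proof.
move=> hU gh Qh Qg x.
have := cartan_flip (match x with GE => GF | GF => GE | y => y end) hU gh Qh Qg.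
by case: x.
Qed.

End Transposes.

(* The anti-automorphism exchanging E and F maps R to its flip. *)
Definition cas13_cotwist (K : fieldType) (q : K) (A : algType K) (g1 g2 g3 : gen -> A) : A :=
  @cas13_twist K q (A^c : algType K) (exchEF g1) (exchEF g2) (exchEF g3).

Definition Rtterm (K : fieldType) (A : algType K) (g h : gen -> A) : A :=
  g GF * g GK * (h GL * h GE).

Section Intertwiners.
Variables (K : fieldType) (q : K) (A : algType K) (b : nat -> K) (N : nat).
Variables (Q : A) (g1 g2 g3 : gen -> A).
Hypotheses (q0 : q != 0).
Hypotheses (g1U : usl2_gens q g1) (g2U : usl2_gens q g2) (g3U : usl2_gens q g3).
Hypotheses (g12 : commuting g1 g2) (g13 : commuting g1 g3) (g23 : commuting g2 g3).
Hypothesis bS : forall n, (n < N)%N ->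
  b n.+1 * (q ^+ n.+1 - q ^- n.+1) = q ^+ n * b n.
Local Notation Ac := (A^c : algType K).

Let g32 : commuting g3 g2. Proof. by move=> a c; rewrite g23. Qed.

(** This is [cas13_twist_R] in the opposite algebra, with q^H and q^{-H} exchanged and the slots
    reversed; the twist is fixed by [cas13_twist_rev], and C_13 by a direct computation. *)
Lemma cas13_twist_Rt : Rtterm g2 g3 ^+ N = 0 ->
  cartan_conj Q g2 g3 -> cartan_conj Q g3 g2 -> (forall x, Q * g1 x = g1 x * Q) ->
  qexp b N (Rtterm g2 g3) * Q * cas13_twist q g1 g2 g3 =
  cas q (coprod g1 g3) * (qexp b N (Rtterm g2 g3) * Q).
Proof.
move=> yN Q23 Q32 Q1.
have := @cas13_twist_R K q Ac b N Q (exchKL g3) (exchKL g2) (exchKL g1) q0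
 (exchKL_gens q0 g3U) (exchKL_gens q0 g2U) (exchKL_gens q0 g1U)
 (exchKL_commuting g23) (exchKL_commuting g13) (exchKL_commuting g12) bS.
rewrite qexp_converse revrX cas13_twist_rev// => /(_ yN) /(_ _ _ _)/wrap[].
- exact: (exchKL_cartan g2U g32 Q23 Q32).
- exact: (exchKL_cartan g3U g23 Q32 Q23).
- by case; rewrite /exchKL; exact/esym/Q1.
have -> : @cas K q Ac (@coprod K Ac (exchKL g3) (exchKL g1)) = cas q (coprod g1 g3).
  by usl2_ring q g1 g2 g3.
by [].
Qed.

End Intertwiners.

Section Cotwist.
Variables (K : fieldType) (q : K) (A : algType K) (b : nat -> K) (N : nat).
Variables (Q : A) (g1 g2 g3 : gen -> A).
Hypotheses (q0 : q != 0).
Hypotheses (g1U : usl2_gens q g1) (g2U : usl2_gens q g2) (g3U : usl2_gens q g3).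
Hypotheses (g12 : commuting g1 g2) (g13 : commuting g1 g3) (g23 : commuting g2 g3).
Hypothesis bS : forall n, (n < N)%N ->
  b n.+1 * (q ^+ n.+1 - q ^- n.+1) = q ^+ n * b n.
Local Notation Ac := (A^c : algType K).

Let g21 : commuting g2 g1. Proof. by move=> a c; rewrite g12. Qed.
Let g32 : commuting g3 g2. Proof. by move=> a c; rewrite g23. Qed.

Let cas13_converse :
  @cas K q Ac (@coprod K Ac (exchEF g1) (exchEF g3)) = cas q (coprod g1 g3).
Proof. by usl2_ring q g1 g2 g3. Qed.

(** The anti-automorphism exchanging E and F keeps the slots in place, fixes C_13 and maps R_12 to
    its flip, so it carries over [cas13_twist_R]. *)
Lemma cas13_cotwist_Rt : Rtterm g1 g2 ^+ N = 0 ->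
  cartan_conj Q g1 g2 -> cartan_conj Q g2 g1 -> (forall x, Q * g3 x = g3 x * Q) ->
  qexp b N (Rtterm g1 g2) * Q * cas13_cotwist q g1 g2 g3 =
  cas q (coprod g1 g3) * (qexp b N (Rtterm g1 g2) * Q).
Proof.
move=> yN Q12 Q21 Q3.
have := @cas13_twist_R K q Ac b N Q (exchEF g1) (exchEF g2) (exchEF g3) q0
 (exchEF_gens q0 g1U) (exchEF_gens q0 g2U) (exchEF_gens q0 g3U)
 (exchEF_commuting g12) (exchEF_commuting g13) (exchEF_commuting g23) bS.
have -> : @Rterm K Ac (exchEF g1) (exchEF g2) = Rtterm g1 g2.
  by rewrite /Rterm /Rtterm; usl2_ring q g1 g2 g3.
rewrite qexp_converse revrX cas13_converse => /(_ yN) /(_ _ _ _)/wrap[] //.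
- exact: (exchEF_cartan g2U g12 Q21 Q12).
- exact: (exchEF_cartan g1U g21 Q12 Q21).
- by case; exact/esym/Q3.
Qed.

(** Here the exchange of E and F is applied to [cas13_twist_Rt], so that the flip in slots 2 and 3
    becomes R_23. *)
Lemma cas13_cotwist_R : Rterm g2 g3 ^+ N = 0 ->
  cartan_conj Q g2 g3 -> cartan_conj Q g3 g2 -> (forall x, Q * g1 x = g1 x * Q) ->
  cas13_cotwist q g1 g2 g3 * (Q * qexp b N (Rterm g2 g3)) =
  Q * qexp b N (Rterm g2 g3) * cas q (coprod g1 g3).
Proof.
move=> yN Q23 Q32 Q1.
have := @cas13_twist_Rt K q Ac b N Q (exchEF g1) (exchEF g2) (exchEF g3) q0
 (exchEF_gens q0 g1U) (exchEF_gens q0 g2U) (exchEF_gens q0 g3U)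
 (exchEF_commuting g12) (exchEF_commuting g13) (exchEF_commuting g23) bS.
have -> : @Rtterm K Ac (exchEF g2) (exchEF g3) = Rterm g2 g3.
  by rewrite /Rterm /Rtterm; usl2_ring q g1 g2 g3.
rewrite qexp_converse revrX cas13_converse => /(_ yN) /(_ _ _ _)/wrap[] //.
- exact: (exchEF_cartan g3U g23 Q32 Q23).
- exact: (exchEF_cartan g2U g32 Q23 Q32).
- by case; exact/esym/Q1.
Qed.

Lemma cas13_cotwist_comm x :
  GRing.comm (coprod (coprod g1 g2) g3 x) (cas13_cotwist q g1 g2 g3).
Proof.
by rewrite /GRing.comm /cas13_cotwist; case: x; usl2_ring q g1 g2 g3.
Qed.

End Cotwist.

(** * Elements of U (x) U (x) U *)

Section Transport.
Variables (K : fieldType) (q : K) (A B : algType K) (f : A -> B).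
Hypotheses (fL : linear f) (fM : monoid_morphism f).

Let fA : {lrmorphism A -> B} :=
  HB.pack f (GRing.isLinear.Build K A B *:%R f fL) (GRing.isMonoidMorphism.Build A B f fM).
Let fD x y : f (x + y) = f x + f y. Proof. exact: (raddfD fA). Qed.
Let fB x y : f (x - y) = f x - f y. Proof. exact: (raddfB fA). Qed.
Let fN x : f (- x) = - f x. Proof. exact: (raddfN fA). Qed.
Let fZ c x : f (c *: x) = c *: f x. Proof. exact: (linearZZ fA). Qed.
Let fmul x y : f (x * y) = f x * f y. Proof. exact: (rmorphM fA). Qed.
Let fX x n : f (x ^+ n) = f x ^+ n. Proof. exact: (rmorphXn fA). Qed.
Let f1 : f 1 = 1. Proof. exact: (rmorph1 fA). Qed.
Let fS (I : Type) (r : seq I) (F : I -> A) :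
  f (\sum_(i <- r) F i) = \sum_(i <- r) f (F i).
Proof. exact: (raddf_sum fA). Qed.

Lemma morph_usl2_gens g : usl2_gens q g -> usl2_gens q (f \o g).
Proof.
move=> [kl lk ke kf ef]; split; rewrite /= -!fmul.
- by rewrite kl.
- by rewrite lk.
- by rewrite ke fZ.
- by rewrite kf fZ.
- by rewrite -fB ef fZ fB !fX.
Qed.

Lemma morph_commuting g h : commuting g h -> commuting (f \o g) (f \o h).
Proof. by move=> gh a b; rewrite /= -!fmul gh. Qed.

Lemma morph_cas g : f (cas q g) = cas q (f \o g).
Proof. by rewrite /cas !(fD, fmul, fZ, fX). Qed.

Lemma morph_coprod g h x : f (coprod g h x) = coprod (f \o g) (f \o h) x.
Proof. by case: x; rewrite /= !(fD, fmul). Qed.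

Lemma morph_cas13_twist g1 g2 g3 :
  f (cas13_twist q g1 g2 g3) = cas13_twist q (f \o g1) (f \o g2) (f \o g3).
Proof.
rewrite /cas13_twist /twistF /twistE /twistK.
by rewrite !(morph_cas, morph_coprod, fD, fN, fZ, fmul, fX).
Qed.

Lemma morph_cartan (Q : A) g h :
  cartan_conj Q g h -> cartan_conj (f Q) (f \o g) (f \o h).
Proof.
move=> Qgh x; rewrite /= -fmul Qgh !fmul.
by case: x; rewrite /= ?f1 ?fX.
Qed.

Lemma morph_qexp b N y : f (qexp b N y) = qexp b N (f y).
Proof. by rewrite /qexp fS; apply: eq_bigr => n _; rewrite fZ fX. Qed.

Lemma morph_exp0 N y : y ^+ N = 0 -> f y ^+ N = 0.
Proof. by rewrite -fX => ->; exact: (raddf0 fA). Qed.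

Lemma morph_Rterm g h : f (Rterm g h) = Rterm (f \o g) (f \o h).
Proof. by rewrite /Rterm !fmul. Qed.

Lemma morph_Rtterm g h : f (Rtterm g h) = Rtterm (f \o g) (f \o h).
Proof. by rewrite /Rtterm !fmul. Qed.

End Transport.

(** [cas13_cotwist] is formed with the opposite product, and a morphism of algebras is also one of
    the opposite algebras. *)
Lemma morph_cas13_cotwist (K : fieldType) (q : K) (A B : algType K) (f : A -> B) g1 g2 g3 :
  linear f -> monoid_morphism f ->
  f (cas13_cotwist q g1 g2 g3) = cas13_cotwist q (f \o g1) (f \o g2) (f \o g3).
Proof.
move=> fL [f1 fM].
have fcM : @monoid_morphism (A^c : algType K) (B^c : algType K) f.
  by split=> [|x y]; [exact: f1 | exact: fM].
rewrite /cas13_cotwist (@morph_cas13_twist K q (A^c : algType K) (B^c : algType K) f fL fcM).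
have ex g : f \o exchEF g = exchEF (f \o g) by apply: boolp.funext; case.
by rewrite !ex.
Qed.

Section TensMorphisms.
Variables (K : fieldType) (A B : algType K).

Lemma tpure_linearl (b : B) : linear (fun a : A => a \ox b).
Proof. exact: (tpure_bilin A B).1. Qed.

Lemma tpure_linearr (a : A) : linear (fun b : B => a \ox b).
Proof. exact: (tpure_bilin A B).2. Qed.

Lemma tpure_monoidl : monoid_morphism (fun a : A => a \ox (1 : B)).
Proof. by split=> // a a'; rewrite tpureM mulr1. Qed.

Lemma tpure_monoidr : monoid_morphism (fun b : B => (1 : A) \ox b).
Proof. by split=> // b b'; rewrite tpureM mulr1. Qed.

Lemma tlift_alg_monoid (C : algType K) (f : A -> B -> C) : bilin f ->
  f 1 1 = 1 -> (forall a b c d, f (a * c) (b * d) = f a b * f c d) ->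
  monoid_morphism (tlift f).
Proof.
move=> fb f1 fM; have hl := tlift_linear fb; have hE := tliftE fb.
move: (tlift f) hl hE => h hl hE.
have h0 := linear_map0 hl; have hD := linear_mapD hl.
split=> [|X Y]; first by rewrite [1]tens1E hE.
elim/tens_ind: X => [|a b X IH]; first by rewrite mul0r h0 mul0r.
rewrite mulrDl !hD mulrDl -IH; congr (_ + _).
elim/tens_ind: Y {IH} => [|c d Y IH]; first by rewrite mulr0 h0 mulr0.
by rewrite mulrDr !hD mulrDr -IH tpureM !hE fM.
Qed.

End TensMorphisms.

Section Generators.
Variables (K : fieldType) (q s : K).
Hypotheses (s0 : s != 0) (s2 : s ^+ 2 = q) (lam0 : q - q^-1 != 0).
Local Notation U := (Uq q).
Local Notation U3 := (tens (tens U U) U).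
Local Notation lam := (q - q^-1).

Let q0 : q != 0. Proof. by rewrite -s2 expf_neq0. Qed.

Definition ugen (x : gen) : U :=
  match x with
  | GE => lam *: uE q | GF => lam *: uF q | GK => uK q | GL => uKi q
  end.

Definition in1 (x : U) : U3 := x \ox 1 \ox 1.
Definition in2 (x : U) : U3 := 1 \ox x \ox 1.
Definition in3 (x : U) : U3 := 1 \ox x.

Lemma ugen_gens : usl2_gens q ugen.
Proof.
case: (Uq_rels q) => kl lk ke kf ef; split=> //=.
- by rewrite -scalerAr ke -scalerAl !scalerA mulrC.
- by rewrite -scalerAr kf -scalerAl !scalerA mulrC.
rewrite -!scalerAl -!scalerAr -!scalerBr ef !scalerA.
by rewrite mulfK.
Qed.

Lemma in1_linear : linear in1.
Proof. by move=> c x y; rewrite /in1 !tpure_linearl. Qed.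
Lemma in2_linear : linear in2.
Proof. by move=> c x y; rewrite /in2 tpure_linearr tpure_linearl. Qed.
Lemma in3_linear : linear in3.
Proof. exact: tpure_linearr. Qed.

Lemma in1_monoid : monoid_morphism in1.
Proof. by split=> // x y; rewrite /in1 !tpureM !mulr1. Qed.
Lemma in2_monoid : monoid_morphism in2.
Proof. by split=> // x y; rewrite /in2 !tpureM !mulr1. Qed.
Lemma in3_monoid : monoid_morphism in3.
Proof. exact: tpure_monoidr. Qed.

Lemma in1_gens : usl2_gens q (in1 \o ugen).
Proof. by apply: (morph_usl2_gens (@in1_linear) (@in1_monoid)); exact: ugen_gens. Qed.
Lemma in2_gens : usl2_gens q (in2 \o ugen).
Proof. by apply: (morph_usl2_gens (@in2_linear) (@in2_monoid)); exact: ugen_gens. Qed.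
Lemma in3_gens : usl2_gens q (in3 \o ugen).
Proof. by apply: (morph_usl2_gens (@in3_linear) (@in3_monoid)); exact: ugen_gens. Qed.

Lemma in12_commuting : commuting (in1 \o ugen) (in2 \o ugen).
Proof. by move=> a b; rewrite /= /in1 /in2 !tpureM !mulr1 !mul1r. Qed.
Lemma in13_commuting : commuting (in1 \o ugen) (in3 \o ugen).
Proof. by move=> a b; rewrite /= /in1 /in3 !tpureM !mulr1 !mul1r. Qed.
Lemma in23_commuting : commuting (in2 \o ugen) (in3 \o ugen).
Proof. by move=> a b; rewrite /= /in2 /in3 !tpureM !mulr1 !mul1r. Qed.

Lemma Delta_ugen x : Delta (ugen x) =
  coprod ((fun u => u \ox 1) \o ugen) ((fun u => 1 \ox u) \o ugen) x.
Proof.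
have [dE dF dK dL] := uliftE (Delta_rels q0).
have dZ := linear_mapZ (Delta_linear s0 s2).
case: x; rewrite /= ?dZ ?dE ?dF ?dK ?dL !tpureM !mulr1 !mul1r //.
all: by rewrite [Delta _](dE, dF) scalerDr tpureZl tpureZr.
Qed.

End Generators.

Section Centralizer.
Variables (K : fieldType) (q s : K).
Hypotheses (s0 : s != 0) (s2 : s ^+ 2 = q) (lam0 : q - q^-1 != 0).
Local Notation U := (Uq q).
Local Notation U3 := (tens (tens U U) U).
Local Notation lam := (q - q^-1).
Local Notation inU i := (i \o @ugen K q).

Let q0 : q != 0. Proof. by rewrite -s2 expf_neq0. Qed.

Let Delta_id_bilin : bilin (fun x y : U => Delta x \ox y).
Proof.
split=> [y c x x'|x c y y']; last by rewrite tpure_linearr.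
by rewrite (Delta_linear s0 s2) tpure_linearl.
Qed.

Let slot13_bilin : bilin (fun x y : U => x \ox (1 : U) \ox y).
Proof.
by split=> [y c x x'|x c y y']; rewrite ?tpure_linearr // !tpure_linearl.
Qed.

Lemma Delta_id_linear : linear (@Delta_id K q).
Proof. exact: tlift_linear Delta_id_bilin. Qed.

Lemma slot13_linear : linear (@slot13 K q).
Proof. exact: tlift_linear slot13_bilin. Qed.

Lemma Delta_id_monoid : monoid_morphism (@Delta_id K q).
Proof.
have [D1 DM] := Delta_monoid s0 s2.
by apply: tlift_alg_monoid Delta_id_bilin _ _ => [|a b c d]; rewrite ?D1 // DM tpureM.
Qed.

Lemma slot13_monoid : monoid_morphism (@slot13 K q).
Proof.
by apply: tlift_alg_monoid slot13_bilin _ _ => [|a b c d] //; rewrite !tpureM mulr1.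
Qed.

Lemma casimir_ugen : casimir q = - (q + q^-1)^-1 *: cas q (@ugen K q).
Proof.
rewrite /casimir /cas /= -scalerAl -scalerAr scalerA -expr2.
rewrite [RHS](_ : _ = (- (q + q^-1)^-1 * lam ^+ 2) *: (uF q * uE q +
   (lam ^+ 2)^-1 *: (q *: uK q ^+ 2 + q^-1 *: uKi q ^+ 2))).
  by rewrite mulNr mulrC.
by rewrite -scalerA [in RHS]scalerDr scalerA divff ?expf_neq0 // scale1r.
Qed.

(** [slot13] after [Delta] is an algebra morphism, so it sends the Casimir expression in the
    generators to the same expression in their coproducts. *)
Lemma casimir13E : casimir13 q =
  - (q + q^-1)^-1 *: cas q (coprod (inU (@in1 K q)) (inU (@in3 K q))).
Proof.
have fL : linear (@slot13 K q \o @Delta K q).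
  by move=> c x y; rewrite /= (Delta_linear s0 s2) slot13_linear.
have fM : monoid_morphism (@slot13 K q \o @Delta K q).
  have [D1 DM] := Delta_monoid s0 s2; have [S1 SM] := slot13_monoid.
  by split=> [|x y]; rewrite /= ?D1 ?S1 // DM SM.
rewrite /casimir13 casimir_ugen -[LHS]/((@slot13 K q \o @Delta K q) _).
rewrite (linear_mapZ fL) (morph_cas _ fL fM).
congr (_ *: cas _ _); apply: boolp.funext => x; rewrite /= (Delta_ugen s0 s2).
rewrite (morph_coprod slot13_linear slot13_monoid).
by case: x; rewrite /= /slot13 !tliftE.
Qed.

Lemma Delta3_ugen x : Delta_id (Delta (@ugen K q x)) =
  coprod (coprod (inU (@in1 K q)) (inU (@in2 K q))) (inU (@in3 K q)) x.
Proof.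
rewrite (Delta_ugen s0 s2) (morph_coprod Delta_id_linear Delta_id_monoid).
have -> : @Delta_id K q \o ((fun u => 1 \ox u) \o @ugen K q) = inU (@in3 K q).
  apply: boolp.funext => y; rewrite /= /Delta_id tliftE //.
  by rewrite (Delta_monoid s0 s2).1.
congr (coprod _ _ x); apply: boolp.funext => {}x; rewrite /= /Delta_id tliftE //.
rewrite (Delta_ugen s0 s2).
exact: (@morph_coprod _ _ U3 (fun X => X \ox 1) (tpure_linearl 1) (@tpure_monoidl _ _ _)).
Qed.

(** Since q - q^-1 is nonzero, E and F are recovered from the rescaled generators by division;
    commutation then passes to sums and products. *)
Lemma comm_ugen (A : algType K) (f : U -> A) (c : K) (X : A) :
  linear f -> monoid_morphism f -> (forall x, GRing.comm (f (@ugen K q x)) X) ->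
  forall u, GRing.comm (f u) (c *: X).
Proof.
move=> fL [f1 fM] fX u.
rewrite /GRing.comm -scalerAr -scalerAl; congr (_ *: _).
have fD := linear_mapD fL; have fZ := linear_mapZ fL.
have fV (y : U) : GRing.comm (f (lam *: y)) X -> f y * X = X * f y.
  rewrite /GRing.comm fZ -scalerAl -scalerAr => /(congr1 (fun z => lam^-1 *: z)).
  by rewrite !scalerA mulVf // !scale1r.
elim/Uq_ind: u => [||||d|y z IHy IHz|y z IHy IHz].
- exact: fV (fX GE).
- exact: fV (fX GF).
- exact: fX GK.
- exact: fX GL.
- by rewrite fZ f1 -scalerAl -scalerAr mul1r mulr1.
- by rewrite fD mulrDl mulrDr IHy IHz.
- by rewrite fM -mulrA IHz mulrA IHy mulrA.
Qed.

Lemma centralizer3_ugen (X : U3) c :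
  (forall x, GRing.comm
     (coprod (coprod (inU (@in1 K q)) (inU (@in2 K q))) (inU (@in3 K q)) x) X) ->
  centralizer3 (c *: X).
Proof.
move=> Xcomm x; apply/eqP; rewrite subr_eq0; apply/eqP.
have fL : linear (@Delta_id K q \o @Delta K q).
  by move=> d y z; rewrite /= (Delta_linear s0 s2) Delta_id_linear.
have fM : monoid_morphism (@Delta_id K q \o @Delta K q).
  have [D1 DM] := Delta_monoid s0 s2; have [S1 SM] := Delta_id_monoid.
  by split=> [|y z]; rewrite /= ?D1 ?S1 // DM SM.
apply: (comm_ugen c fL fM) => y; rewrite [_ (ugen q y)]Delta3_ugen.
exact: Xcomm.
Qed.

End Centralizer.

(** * The completion *)

Section TensMatrix.
Variables (K : fieldType).

Lemma tensmxA m1 n1 m2 n2 m3 n3 (A : 'M[K]_(m1, n1)) (B : 'M[K]_(m2, n2))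
    (C : 'M[K]_(m3, n3)) :
  castmx (mulnA m1 m2 m3, mulnA n1 n2 n3) (A *t (B *t C)) = A *t B *t C.
Proof.
apply/matrixP => i j; rewrite castmxE /=.
case: (mxtens_indexP i) => i12 i3; case: (mxtens_indexP i12) => i1 i2.
case: (mxtens_indexP j) => j12 j3; case: (mxtens_indexP j12) => j1 j2.
(* Both bracketings give a triple of indices the same lexicographic position. *)
have idx p r t (k1 : 'I_p) (k2 : 'I_r) (k3 : 'I_t) :
    cast_ord (esym (mulnA p r t)) (mxtens_index (mxtens_index (k1, k2), k3)) =
    mxtens_index (k1, mxtens_index (k2, k3)).
  by apply: val_inj => /=; rewrite mulnDl mulnA addnA.
by rewrite !idx !tensmxE mulrA.
Qed.

Lemma tensmx1 m n : (1%:M : 'M[K]_m) *t (1%:M : 'M[K]_n) = 1%:M.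
Proof.
apply/matrixP => i j; case: (mxtens_indexP i) => i1 i2; case: (mxtens_indexP j) => j1 j2.
rewrite tensmxE !mxE -natrM mulnb (can_eq (@mxtens_indexK _ _)).
by rewrite xpair_eqE.
Qed.

Lemma tens1mxM m n (X Y : 'M[K]_n) :
  ((1%:M : 'M_m) *t X) *m ((1%:M : 'M_m) *t Y) = (1%:M : 'M_m) *t (X *m Y).
Proof. by rewrite tensmx_mul mulmx1. Qed.

Lemma tensmx1M m n (X Y : 'M[K]_n) :
  (X *t (1%:M : 'M_m)) *m (Y *t (1%:M : 'M_m)) = (X *m Y) *t (1%:M : 'M_m).
Proof. by rewrite tensmx_mul mulmx1. Qed.

Lemma castmx_linear m n m' n' (e : (m = m') * (n = n')) : linear (@castmx K _ _ _ _ e).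
Proof. by case: e => em en c x y; case: m' / em; case: n' / en; rewrite !castmx_id. Qed.

Lemma castmxM m n (e : m = n) (X Y : 'M[K]_m) :
  castmx (e, e) (X *m Y) = castmx (e, e) X *m castmx (e, e) Y.
Proof. by case: n / e; rewrite !castmx_id. Qed.

Variables n1 n2 n3 : nat.
Local Notation M12 := ('M[K]_(n1.+1 * n2.+1)).
Local Notation M23 := ('M[K]_(n2.+1 * n3.+1)).
Local Notation M123 := ('M[K]_(n1.+1 * n2.+1 * n3.+1)).

(** [slot12] and [slot23] on one triple of modules, where they are morphisms of matrix algebras. *)
Definition hat12 (X : M12) : M123 := X *t (1%:M : 'M_n3.+1).
Definition hat23 (X : M23) : M123 :=
  castmx (mulnA n1.+1 n2.+1 n3.+1, mulnA n1.+1 n2.+1 n3.+1) ((1%:M : 'M_n1.+1) *t X).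

Lemma hat12_linear : linear hat12.
Proof. by apply: (@tensmx_linear K M12 _ _ _ _ id). Qed.

Lemma hat23_linear : linear hat23.
Proof.
move=> c x y; rewrite /hat23 (@tensmx_linearr K M23 _ _ _ _ _ id) //.
exact: castmx_linear.
Qed.

Lemma hat12_monoid : monoid_morphism hat12.
Proof.
split=> [|x y]; first exact: tensmx1.
by rewrite /hat12 -[RHS]/(_ *m _) tensmx_mul mulmx1.
Qed.

Lemma hat23_monoid : monoid_morphism hat23.
Proof.
split=> [|x y].
  by rewrite /hat23 -[X in _ *t X](tensmx1 n2.+1 n3.+1) tensmxA !tensmx1.
by rewrite /hat23 -[RHS]/(_ *m _) -castmxM tensmx_mul mulmx1.
Qed.

End TensMatrix.

(** * Coefficients and Cartan part of R on two simple modules *)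

Section MatrixR.
Variables (K : fieldType) (q s : K).
Hypotheses (s0 : s != 0) (s2 : s ^+ 2 = q).
Hypothesis q_not_root : forall n, (0 < n)%N -> q ^+ n != 1.
Local Notation U := (Uq q).
Local Notation lam := (q - q^-1).
Local Notation ug := (@ugen K q).

Let q0 : q != 0. Proof. by rewrite -s2 expf_neq0. Qed.

(** An equality q^n = q^-n would give q^(2n) = 1. *)
Lemma qpow_subV_neq0 n : (0 < n)%N -> q ^+ n - q ^- n != 0.
Proof.
move=> n0; have qn0 : q ^+ n != 0 by rewrite expf_neq0.
apply: contraNneq (q_not_root (n := (n + n)%N) ltac:(by rewrite addn_gt0 n0)).
by move/eqP; rewrite subr_eq0 exprD => /eqP {1}->; rewrite mulVf.
Qed.

Lemma qsub_neq0 : lam != 0.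
Proof. by have := qpow_subV_neq0 (ltn0Sn 0); rewrite expr1. Qed.

(* The coefficients of R as a series in (lam E) q^H (x) q^{-H} (lam F). *)
Definition rcoef (n : nat) : K := qcoef q n * (lam ^- 2) ^+ n.

(** Passing from n to n + 1 divides by [n+1], with numerator q^(n+1) - q^-(n+1), and raises the
    exponent n(n-1)/2 by n; the powers of q - q^-1 cancel. *)
Lemma rcoefS n : rcoef n.+1 * (q ^+ n.+1 - q ^- n.+1) = q ^+ n * rcoef n.
Proof.
have d0 := qpow_subV_neq0 (ltn0Sn n); have l0 := qsub_neq0.
rewrite /rcoef /qcoef /qfact big_nat_recr //= -/(qfact q n).
have -> : ((n.+1 * n)./2 = n + (n * n.-1)./2)%N.
  have -> : (n.+1 * n = n.*2 + n * n.-1)%N by case: (n) => // m; lia.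
  by rewrite halfD odd_double doubleK.
rewrite /qint exprD; move: d0 l0; set d := q ^+ n.+1 - _; set l := q - _ => d0 l0.
rewrite [l ^+ n.+1]exprS [l ^- 2 ^+ n.+1]exprS invfM invf_div.
move: (q ^+ (_ ./2)) (qfact q n)^-1 (l ^+ n) (l ^- 2 ^+ n) (q ^+ n) => a p c e r.
by field; rewrite d0 l0.
Qed.

(** In the units of [wt]: twice the eigenvalue of ad H on the generator. *)
Definition weight (x : gen) : int :=
  match x with GE => 2 | GF => - 2 | _ => 0 end.

Lemma rho_ugen n x : rho s n (ug x) =
  match x with
  | GE => lam *: mxE_ q n | GF => lam *: mxF_ q n | GK => mxK_ s n | GL => mxKi_ s n
  end.
Proof.
have [rE rF rK rL] := rho_gens s0 s2 n.
have rZ := linear_mapZ (@rho_linear _ _ _ s0 s2 n).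
by case: x; rewrite /= ?rZ ?rE ?rF.
Qed.

(** A generator shifts weights by [weight x], so the entry at i, j can be nonzero only if [wt n i]
    is [weight x + wt n j]. *)
Lemma rho_weight n x (i j : 'I_n.+1) (z : int) :
  s ^ (wt n i * z) * rho s n (ug x) i j =
  rho s n (ug x) i j * s ^ (weight x * z) * s ^ (wt n j * z).
Proof.
rewrite -mulrA -expfzDr// -mulrDl mulrC rho_ugen.
case: x; rewrite !mxE; case: eqP => [ij|]; rewrite ?(mulr0, mul0r) //.
- by congr (_ * s ^ (_ * _)); rewrite /wt -ij /weight; lia.
- by congr (_ * s ^ (_ * _)); rewrite /wt ij /weight; lia.
- by rewrite ij add0r.
- by rewrite ij add0r.
Qed.

Lemma rho_shift n x : cartan_shift (fun y => rho s n (ug y)) x =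
  diag_mx (\row_j s ^ (weight x * wt n j)).
Proof.
have dg (d : 'rV[K]_n.+1) (z : int) : (forall j, d 0 j ^+ 2 = s ^ (z * wt n j)) ->
    diag_mx d ^+ 2 = diag_mx (\row_j s ^ (z * wt n j)).
  move=> dz; rewrite expr2 -mulmxE mulmx_diag; congr diag_mx.
  by apply/rowP => j; rewrite !mxE -dz expr2.
case: x; rewrite /cartan_shift ?rho_ugen.
- by apply: dg => j; rewrite mxE exprnP exprz_exp mulrC.
- by apply: dg => j; rewrite mxE exprnP exprz_exp mulrC mulrN mulNr.
- by rewrite -[LHS]diag_const_mx; congr diag_mx; apply/rowP => j; rewrite !mxE mul0r expr0z.
- by rewrite -[LHS]diag_const_mx; congr diag_mx; apply/rowP => j; rewrite !mxE mul0r expr0z.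
Qed.

Definition rho12 n1 n2 (x : gen) : 'M[K]_(n1.+1 * n2.+1) := rep2 s n1 n2 (ug x \ox 1).
Definition rho21 n1 n2 (x : gen) : 'M[K]_(n1.+1 * n2.+1) := rep2 s n1 n2 (1 \ox ug x).

Lemma rho12E n1 n2 x : rho12 n1 n2 x = rho s n1 (ug x) *t 1%:M.
Proof. by rewrite /rho12 rep2E // (rho_monoid s0 s2 n2).1. Qed.

Lemma rho21E n1 n2 x : rho21 n1 n2 x = 1%:M *t rho s n2 (ug x).
Proof. by rewrite /rho21 rep2E // (rho_monoid s0 s2 n1).1. Qed.

(** On weights w, w' in the units of [wt], Q acts by s^(w w'). A generator in slot 1 shifts w by
    [weight x], hence the exponent by [weight x] times w', and this is the action of a power of q^H
    in slot 2. *)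
Lemma qHH_cartan n1 n2 : cartan_conj (qHH s n1 n2) (@rho12 n1 n2) (@rho21 n1 n2).
Proof.
move=> x.
have -> : cartan_shift (@rho21 n1 n2) x =
    (1%:M : 'M_n1.+1) *t cartan_shift (fun y => rho s n2 (ug y)) x.
  case: x; rewrite /= ?tensmx1 // rho21E.
  + exact: (tens1mxM n1.+1 (rho s n2 (ug GK)) (rho s n2 (ug GK))).
  + exact: (tens1mxM n1.+1 (rho s n2 (ug GL)) (rho s n2 (ug GL))).
rewrite (rho_shift n2 x) rho12E; set D := diag_mx _.
suff : qHH s n1 n2 *m (rho s n1 (ug x) *t (1%:M : 'M_n2.+1)) =
    (rho s n1 (ug x) *t D) *m qHH s n1 n2 by rewrite (tensmx_decr _ D).
rewrite /qHH mul_diag_mx mul_mx_diag.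
apply/matrixP => i j; case: (mxtens_indexP i) => i1 i2; case: (mxtens_indexP j) => j1 j2.
rewrite !mxE !mxtens_indexK /=.
have [->|_] := eqVneq i2 j2; last by rewrite !(mulr0n, mulr0, mul0r).
by rewrite !mulr1n mulr1 rho_weight.
Qed.

Lemma qHH_cartan' n1 n2 : cartan_conj (qHH s n1 n2) (@rho21 n1 n2) (@rho12 n1 n2).
Proof.
move=> x.
have -> : cartan_shift (@rho12 n1 n2) x =
    cartan_shift (fun y => rho s n1 (ug y)) x *t (1%:M : 'M_n2.+1).
  case: x; rewrite /= ?tensmx1 // rho12E.
  + exact: (tensmx1M n2.+1 (rho s n1 (ug GK)) (rho s n1 (ug GK))).
  + exact: (tensmx1M n2.+1 (rho s n1 (ug GL)) (rho s n1 (ug GL))).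
rewrite (rho_shift n1 x) rho21E; set D := diag_mx _.
suff : qHH s n1 n2 *m ((1%:M : 'M_n1.+1) *t rho s n2 (ug x)) =
    (D *t rho s n2 (ug x)) *m qHH s n1 n2 by rewrite (tensmx_decl D).
rewrite /qHH mul_diag_mx mul_mx_diag.
apply/matrixP => i j; case: (mxtens_indexP i) => i1 i2; case: (mxtens_indexP j) => j1 j2.
rewrite !mxE !mxtens_indexK /=.
have [->|_] := eqVneq i1 j1; last by rewrite !(mulr0n, mulr0, mul0r).
rewrite !mulr1n mul1r [wt n1 j1 * wt n2 i2]mulrC rho_weight [wt n2 j2 * _]mulrC.
by congr (_ * _); rewrite mulrC.
Qed.

End MatrixR.

(** * Intertwining relations on three simple modules *)

Section Assembly.
Variables (K : fieldType) (q s : K).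
Hypotheses (s0 : s != 0) (s2 : s ^+ 2 = q).
Hypothesis q_not_root : forall n, (0 < n)%N -> q ^+ n != 1.
Local Notation U := (Uq q).
Local Notation U3 := (tens (tens U U) U).
Local Notation lam := (q - q^-1).
Local Notation ug := (@ugen K q).
Local Notation b := (@rcoef K q).

Let q0 : q != 0. Proof. by rewrite -s2 expf_neq0. Qed.
Let lam0 : lam != 0. Proof. exact: qsub_neq0 s0 s2 q_not_root. Qed.

Let utensl (u : U) : tens U U := u \ox 1.
Let utensr (u : U) : tens U U := 1 \ox u.

Lemma Rterm_ugen : Rterm (utensl \o ug) (utensr \o ug) =
  lam ^+ 2 *: ((uE q * uK q) \ox (uKi q * uF q)).
Proof.
rewrite /Rterm /= /utensl /utensr !tpureM !mul1r !mulr1.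
by rewrite -scalerAl -scalerAr tpureZl tpureZr scalerA -expr2.
Qed.

Lemma Rtterm_ugen : Rtterm (utensl \o ug) (utensr \o ug) =
  lam ^+ 2 *: ((uF q * uK q) \ox (uKi q * uE q)).
Proof.
rewrite /Rtterm /= /utensl /utensr !tpureM !mul1r !mulr1.
by rewrite -scalerAl -scalerAr tpureZl tpureZr scalerA -expr2.
Qed.

(** The power of q - q^-1 that comes from rescaling E and F cancels against the one in [rcoef]. *)
Lemma qseries_qexp n1 n2 (X Y : tens U U) : Y = lam ^+ 2 *: X ->
  qseries s X n1 n2 = qexp b n1.+1 (rep2 s n1 n2 Y : 'M[K]_(n1.+1 * n2.+1)).
Proof.
move=> ->; rewrite (linear_mapZ (@rep2_linear _ _ _ s0 s2 n1 n2)).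
rewrite /qseries /qexp; apply: eq_bigr => k _.
rewrite exprZn scalerA /rcoef -mulrA -exprMn mulVf ?expf_neq0 //.
by rewrite expr1n mulr1.
Qed.

Lemma rep2_nilpotent n1 n2 (X Y : tens U U) : Y = lam ^+ 2 *: X ->
  rep2 s n1 n2 X ^+ n1.+1 = 0 ->
  (rep2 s n1 n2 Y : 'M[K]_(n1.+1 * n2.+1)) ^+ n1.+1 = 0.
Proof.
move=> -> X0; rewrite (linear_mapZ (@rep2_linear _ _ _ s0 s2 n1 n2)).
by rewrite exprZn [X in _ *: X]X0 scaler0.
Qed.

Section Slots.
Variables n1 n2 n3 : nat.

Lemma hat12_rho12 x : hat12 n3 (rho12 q s n1 n2 x) = rep3 s n1 n2 n3 (in1 (ug x)).
Proof. by rewrite /in1 rep3E // (rho_monoid s0 s2 n3).1. Qed.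

Lemma hat12_rho21 x : hat12 n3 (rho21 q s n1 n2 x) = rep3 s n1 n2 n3 (in2 (ug x)).
Proof. by rewrite /in2 rep3E // (rho_monoid s0 s2 n3).1. Qed.

Lemma hat23_rho12 x : hat23 n1 (rho12 q s n2 n3 x) = rep3 s n1 n2 n3 (in2 (ug x)).
Proof.
rewrite /in2 rep3E // rep2E // /rho12 rep2E //.
by rewrite (rho_monoid s0 s2 n3).1 (rho_monoid s0 s2 n1).1 -tensmxA.
Qed.

Lemma hat23_rho21 x : hat23 n1 (rho21 q s n2 n3 x) = rep3 s n1 n2 n3 (in3 (ug x)).
Proof.
rewrite /in3 rep3E // /rho21 rep2E // -[rep2 s n1 n2 1]/(rep2 s n1 n2 (1 \ox 1)) rep2E //.
by rewrite (rho_monoid s0 s2 n2).1 (rho_monoid s0 s2 n1).1 -tensmxA.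
Qed.

Lemma hat12_in3 (X : 'M[K]_(n1.+1 * n2.+1)) x :
  hat12 n3 X *m rep3 s n1 n2 n3 (in3 (ug x)) = rep3 s n1 n2 n3 (in3 (ug x)) *m hat12 n3 X.
Proof.
rewrite /in3 rep3E // (rep2_monoid s0 s2 n1 n2).1 /hat12.
by rewrite -tensmx_decr -tensmx_decl.
Qed.

Lemma hat23_in1 (X : 'M[K]_(n2.+1 * n3.+1)) x :
  hat23 n1 X *m rep3 s n1 n2 n3 (in1 (ug x)) = rep3 s n1 n2 n3 (in1 (ug x)) *m hat23 n1 X.
Proof.
rewrite /in1 rep3E // rep2E // (rho_monoid s0 s2 n2).1 (rho_monoid s0 s2 n3).1.
rewrite -tensmxA tensmx1 /hat23 -!castmxM; congr castmx.
by rewrite -tensmx_decr -tensmx_decl.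
Qed.

Local Notation M123 := ('M[K]_(n1.+1 * n2.+1 * n3.+1) : algType K).
Local Notation r3 := (@rep3 K q s n1 n2 n3).
Local Notation slot i := (r3 \o (i \o ug) : gen -> M123).
Local Notation G1 := (slot (@in1 K q)).
Local Notation G2 := (slot (@in2 K q)).
Local Notation G3 := (slot (@in3 K q)).

Lemma rep3_algmorph : linear (r3 : U3 -> M123) /\ monoid_morphism (r3 : U3 -> M123).
Proof. by split; [exact: rep3_linear | exact: rep3_monoid]. Qed.

Lemma slot_gens1 : usl2_gens q G1.
Proof.
have [fL fM] := rep3_algmorph.
exact: (morph_usl2_gens fL fM (in1_gens lam0)).
Qed.

Lemma slot_gens2 : usl2_gens q G2.
Proof.
have [fL fM] := rep3_algmorph.
exact: (morph_usl2_gens fL fM (in2_gens lam0)).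
Qed.

Lemma slot_gens3 : usl2_gens q G3.
Proof.
have [fL fM] := rep3_algmorph.
exact: (morph_usl2_gens fL fM (in3_gens lam0)).
Qed.

Lemma slot_comm12 : commuting G1 G2.
Proof.
have [fL fM] := rep3_algmorph.
exact: (morph_commuting fL fM (@in12_commuting K q)).
Qed.

Lemma slot_comm13 : commuting G1 G3.
Proof.
have [fL fM] := rep3_algmorph.
exact: (morph_commuting fL fM (@in13_commuting K q)).
Qed.

Lemma slot_comm23 : commuting G2 G3.
Proof.
have [fL fM] := rep3_algmorph.
exact: (morph_commuting fL fM (@in23_commuting K q)).
Qed.

Lemma hat12_gens1 : @hat12 K n1 n2 n3 \o rho12 q s n1 n2 = G1.
Proof. by apply: boolp.funext => x; exact: hat12_rho12. Qed.
Lemma hat12_gens2 : @hat12 K n1 n2 n3 \o rho21 q s n1 n2 = G2.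
Proof. by apply: boolp.funext => x; exact: hat12_rho21. Qed.
Lemma hat23_gens2 : @hat23 K n1 n2 n3 \o rho12 q s n2 n3 = G2.
Proof. by apply: boolp.funext => x; exact: hat23_rho12. Qed.
Lemma hat23_gens3 : @hat23 K n1 n2 n3 \o rho21 q s n2 n3 = G3.
Proof. by apply: boolp.funext => x; exact: hat23_rho21. Qed.

End Slots.

(** * Images of R and of its flip under an algebra morphism *)

Section Hat.
Variables (m n : nat) (A : algType K) (f : 'M[K]_(m.+1 * n.+1) -> A).
Hypotheses (fL : linear f) (fM : monoid_morphism f).
Local Notation M2 := ('M[K]_(m.+1 * n.+1) : algType K).
Local Notation g := (f \o rho12 q s m n).
Local Notation h := (f \o rho21 q s m n).

Let r2L : linear (@rep2 K q s m n : tens U U -> M2). Proof. exact: rep2_linear. Qed.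
Let r2M : monoid_morphism (@rep2 K q s m n : tens U U -> M2). Proof. exact: rep2_monoid. Qed.

Lemma hat_Rmx : f (Rmx q s m n) = f (qHH s m n) * qexp b m.+1 (Rterm g h).
Proof.
rewrite /Rmx (qseries_qexp _ _ Rterm_ugen) (morph_Rterm r2L r2M) -(morph_Rterm fL fM).
by rewrite -(morph_qexp fL fM) -fM.2.
Qed.

Lemma hat_Rtmx : f (Rtmx q s m n) = qexp b m.+1 (Rtterm g h) * f (qHH s m n).
Proof.
rewrite /Rtmx (qseries_qexp _ _ Rtterm_ugen) (morph_Rtterm r2L r2M) -(morph_Rtterm fL fM).
by rewrite -(morph_qexp fL fM) -fM.2.
Qed.

Lemma hat_Rterm0 : Rterm g h ^+ m.+1 = 0.
Proof.
rewrite -(morph_Rterm fL fM); apply: (morph_exp0 fL fM).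
rewrite -[Rterm _ _](morph_Rterm r2L r2M); apply: (rep2_nilpotent Rterm_ugen).
exact: EK_nilpotent.
Qed.

Lemma hat_Rtterm0 : Rtterm g h ^+ m.+1 = 0.
Proof.
rewrite -(morph_Rtterm fL fM); apply: (morph_exp0 fL fM).
rewrite -[Rtterm _ _](morph_Rtterm r2L r2M); apply: (rep2_nilpotent Rtterm_ugen).
exact: FK_nilpotent.
Qed.

End Hat.

Local Notation inU i := (i \o ug : gen -> U3).

(** The elements of U (x) U (x) U whose images will be C_13^(0) and, for the cotwist, C_13^(1); the
    scalar undoes the normalization of [cas]. *)
Definition casimir13_twist : U3 := - (q + q^-1)^-1 *:
  cas13_twist q (inU (@in1 K q)) (inU (@in2 K q)) (inU (@in3 K q)).
Definition casimir13_cotwist : U3 := - (q + q^-1)^-1 *: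
  cas13_cotwist q (inU (@in1 K q)) (inU (@in2 K q)) (inU (@in3 K q)).

Section Intertwine.
Variables n1 n2 n3 : nat.
Local Notation r3 := (@rep3 K q s n1 n2 n3).
Local Notation M123 := ('M[K]_(n1.+1 * n2.+1 * n3.+1) : algType K).
Local Notation slot i := (r3 \o (i \o ug) : gen -> M123).
Local Notation G1 := (slot (@in1 K q)).
Local Notation G2 := (slot (@in2 K q)).
Local Notation G3 := (slot (@in3 K q)).
Local Notation R12 := (hat12 n3 (Rmx q s n1 n2)).
Local Notation R23 := (hat23 n1 (Rmx q s n2 n3)).
Local Notation Rt12 := (hat12 n3 (Rtmx q s n1 n2)).
Local Notation Rt23 := (hat23 n1 (Rtmx q s n2 n3)).

Let fL : linear (r3 : U3 -> M123). Proof. exact: (rep3_algmorph n1 n2 n3).1. Qed.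
Let fM : monoid_morphism (r3 : U3 -> M123). Proof. exact: (rep3_algmorph n1 n2 n3).2. Qed.
Let r3Z := linear_mapZ fL.

Let r3C : r3 (casimir13 q) = - (q + q^-1)^-1 *: (cas q (coprod G1 G3) : M123).
Proof.
rewrite (casimir13E s0 s2 lam0) r3Z; congr (_ *: _).
rewrite (morph_cas q fL fM); congr (cas q _).
by apply: boolp.funext => x; exact: (morph_coprod fL fM).
Qed.

Let scale_intertwine (c : K) (X R C : M123) :
  X * R = R * C -> (c *: X) *m R = R *m (c *: C).
Proof. by move=> XR; rewrite -scalemxAl -scalemxAr; congr (_ *: _). Qed.

Let g1U := slot_gens1 n1 n2 n3.
Let g2U := slot_gens2 n1 n2 n3.
Let g3U := slot_gens3 n1 n2 n3.
Let g12 := slot_comm12 n1 n2 n3.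
Let g13 := slot_comm13 n1 n2 n3.
Let g23 := slot_comm23 n1 n2 n3.
Let h12L := @hat12_linear K n1 n2 n3.
Let h12M := @hat12_monoid K n1 n2 n3.
Let h23L := @hat23_linear K n1 n2 n3.
Let h23M := @hat23_monoid K n1 n2 n3.

Let Q12 : cartan_conj (hat12 n3 (qHH s n1 n2) : M123) G1 G2.
Proof.
rewrite -hat12_gens1 -hat12_gens2; apply: (morph_cartan h12L h12M).
exact: qHH_cartan.
Qed.
Let Q21 : cartan_conj (hat12 n3 (qHH s n1 n2) : M123) G2 G1.
Proof.
rewrite -hat12_gens1 -hat12_gens2; apply: (morph_cartan h12L h12M).
exact: qHH_cartan'.
Qed.
Let Q23 : cartan_conj (hat23 n1 (qHH s n2 n3) : M123) G2 G3.
Proof.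
rewrite -hat23_gens2 -hat23_gens3; apply: (morph_cartan h23L h23M).
exact: qHH_cartan.
Qed.
Let Q32 : cartan_conj (hat23 n1 (qHH s n2 n3) : M123) G3 G2.
Proof.
rewrite -hat23_gens2 -hat23_gens3; apply: (morph_cartan h23L h23M).
exact: qHH_cartan'.
Qed.

Lemma casimir13_twist_R12 : r3 casimir13_twist *m R12 = R12 *m r3 (casimir13 q).
Proof.
rewrite r3Z r3C; apply: scale_intertwine.
rewrite (morph_cas13_twist q fL fM) (hat_Rmx h12L h12M) hat12_gens1 hat12_gens2.
apply: cas13_twist_R => //.
- by move=> n _; exact: (rcoefS s0 s2 q_not_root).
- by rewrite -hat12_gens1 -hat12_gens2; exact: hat_Rterm0 h12L h12M.
- by move=> x; exact: hat12_in3.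
Qed.

Lemma casimir13_twist_Rt23 : Rt23 *m r3 casimir13_twist = r3 (casimir13 q) *m Rt23.
Proof.
rewrite r3Z r3C; apply/esym/scale_intertwine/esym.
rewrite (morph_cas13_twist q fL fM) (hat_Rtmx h23L h23M) hat23_gens2 hat23_gens3.
apply: cas13_twist_Rt => //.
- by move=> n _; exact: (rcoefS s0 s2 q_not_root).
- by rewrite -hat23_gens2 -hat23_gens3; exact: hat_Rtterm0 h23L h23M.
- by move=> x; exact: hat23_in1.
Qed.

Lemma casimir13_cotwist_R23 : r3 casimir13_cotwist *m R23 = R23 *m r3 (casimir13 q).
Proof.
rewrite r3Z r3C; apply: scale_intertwine.
rewrite (morph_cas13_cotwist q _ _ _ fL fM) (hat_Rmx h23L h23M) hat23_gens2 hat23_gens3.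
apply: cas13_cotwist_R => //.
- by move=> n _; exact: (rcoefS s0 s2 q_not_root).
- by rewrite -hat23_gens2 -hat23_gens3; exact: hat_Rterm0 h23L h23M.
- by move=> x; exact: hat23_in1.
Qed.

Lemma casimir13_cotwist_Rt12 : Rt12 *m r3 casimir13_cotwist = r3 (casimir13 q) *m Rt12.
Proof.
rewrite r3Z r3C; apply/esym/scale_intertwine/esym.
rewrite (morph_cas13_cotwist q _ _ _ fL fM) (hat_Rtmx h12L h12M) hat12_gens1 hat12_gens2.
apply: cas13_cotwist_Rt => //.
- by move=> n _; exact: (rcoefS s0 s2 q_not_root).
- by rewrite -hat12_gens1 -hat12_gens2; exact: hat_Rtterm0 h12L h12M.
- by move=> x; exact: hat12_in3.
Qed.

End Intertwine.

Lemma casimir13_twist_centralizer : centralizer3 casimir13_twist.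
Proof.
apply: (centralizer3_ugen s0 s2 lam0) => x; apply: cas13_twist_comm => //.
- exact: in1_gens.
- exact: in2_gens.
- exact: in3_gens.
- exact: in12_commuting.
- exact: in13_commuting.
- exact: in23_commuting.
Qed.

Lemma casimir13_cotwist_centralizer : centralizer3 casimir13_cotwist.
Proof.
apply: (centralizer3_ugen s0 s2 lam0) => x; apply: cas13_cotwist_comm => //.
- exact: in1_gens.
- exact: in2_gens.
- exact: in3_gens.
- exact: in12_commuting.
- exact: in13_commuting.
- exact: in23_commuting.
Qed.

End Assembly.

(** * From intertwining relations to conjugates *)

Lemma hat_unit (K : fieldType) m n (f : 'M[K]_m -> 'M[K]_n) X :
  {morph f : x y / x *m y} -> f 1%:M = 1%:M -> X \in unitmx -> f X \in unitmx.
Proof.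
move=> fM f1 XU; have := fM X (invmx X); rewrite mulmxV // f1 => /esym XV.
by have [] := mulmx1_unit XV.
Qed.

Lemma conj_mx_l (K : fieldType) n (R X C : 'M[K]_n) : R \in unitmx ->
  R *m X = C *m R -> invmx R *m C *m R = X.
Proof. by move=> RU RX; rewrite -mulmxA -RX mulKmx. Qed.

Lemma conj_mx_r (K : fieldType) n (R X C : 'M[K]_n) : R \in unitmx ->
  X *m R = R *m C -> R *m C *m invmx R = X.
Proof. by move=> RU RX; rewrite -RX mulmxK. Qed.

Lemma hat_funext (K : fieldType) (X Y : Uhat3 K) :
  (forall n1 n2 n3, X n1 n2 n3 = Y n1 n2 n3) -> X = Y.
Proof.
move=> XY; apply: boolp.functional_extensionality_dep => n1.
by apply: boolp.functional_extensionality_dep => n2; apply: boolp.functional_extensionality_dep.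
Qed.

Theorem theorem3p1 (R : realType) (q s : R[i])
    (q_neq0 : q != 0)
    (q_not_root_of_unity : forall n : nat, (0 < n)%N -> q ^+ n != 1)
    (s_sqrt_q : s ^+ 2 = q) :
  let C13 := to_hat3 s (casimir13 q) in
  let R12 := slot12 (Rmx q s) in
  let R23 := slot23 (Rmx q s) in
  let Rt12 := slot12 (Rtmx q s) in
  let Rt23 := slot23 (Rtmx q s) in
  let C13_0 := hat_mul (hat_mul (hat_inv Rt23) C13) Rt23 in
  let C13_1 := hat_mul (hat_mul (hat_inv Rt12) C13) Rt12 in
  [/\ C13_0 = hat_mul (hat_mul R12 C13) (hat_inv R12),
      C13_1 = hat_mul (hat_mul R23 C13) (hat_inv R23),
      exists2 X : tens (tens (Uq q) (Uq q)) (Uq q),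
        to_hat3 s X = C13_0 & centralizer3 X
    & exists2 X : tens (tens (Uq q) (Uq q)) (Uq q),
        to_hat3 s X = C13_1 & centralizer3 X].
Proof.
have s0 : s != 0 by apply: contra_neq q_neq0 => s0; rewrite -s_sqrt_q s0 expr0n.
move=> C13 R12 R23 Rt12 Rt23 C13_0 C13_1.
have R12U n1 n2 n3 : R12 n1 n2 n3 \in unitmx.
  apply: (@hat_unit _ _ _ (@hat12 _ n1 n2 n3)) (Rmx_unit s0 s_sqrt_q n1 n2).
    exact: (hat12_monoid _ _ _ _).2.
  exact: (hat12_monoid _ _ _ _).1.
have Rt12U n1 n2 n3 : Rt12 n1 n2 n3 \in unitmx.
  apply: (@hat_unit _ _ _ (@hat12 _ n1 n2 n3)) (Rtmx_unit s0 s_sqrt_q n1 n2).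
    exact: (hat12_monoid _ _ _ _).2.
  exact: (hat12_monoid _ _ _ _).1.
have R23U n1 n2 n3 : R23 n1 n2 n3 \in unitmx.
  apply: (@hat_unit _ _ _ (@hat23 _ n1 n2 n3)) (Rmx_unit s0 s_sqrt_q n2 n3).
    exact: (hat23_monoid _ _ _ _).2.
  exact: (hat23_monoid _ _ _ _).1.
have Rt23U n1 n2 n3 : Rt23 n1 n2 n3 \in unitmx.
  apply: (@hat_unit _ _ _ (@hat23 _ n1 n2 n3)) (Rtmx_unit s0 s_sqrt_q n2 n3).
    exact: (hat23_monoid _ _ _ _).2.
  exact: (hat23_monoid _ _ _ _).1.
(* Each conjugate is compared with the image of one explicit element of U (x) U (x) U; this gives
   both the equality of conjugates and a preimage in the centralizer. *)
have E0 : C13_0 = to_hat3 s (casimir13_twist q).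
  apply: hat_funext => n1 n2 n3; apply: conj_mx_l => //.
  exact: casimir13_twist_Rt23.
have E1 : C13_1 = to_hat3 s (casimir13_cotwist q).
  apply: hat_funext => n1 n2 n3; apply: conj_mx_l => //.
  exact: casimir13_cotwist_Rt12.
split.
- rewrite E0; apply: hat_funext => n1 n2 n3; apply/esym/conj_mx_r => //.
  exact: casimir13_twist_R12.
- rewrite E1; apply: hat_funext => n1 n2 n3; apply/esym/conj_mx_r => //.
  exact: casimir13_cotwist_R23.
- by exists (casimir13_twist q) => //; exact: (casimir13_twist_centralizer s0).
- by exists (casimir13_cotwist q) => //; exact: (casimir13_cotwist_centralizer s0).
Qed.
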